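(* Let $\mathsf{G}$ be a graph with node features, $v,u$ nodes, and consider an MPNN of depth $m$ as in the context, with message-passing matrix $\mathsf{A}=\mathsf{A}_{\mathrm{sym}}:=\mathbf{D}^{-1/2}\mathbf{A}\mathbf{D}^{-1/2}$ and constants satisfying $\max\{\mathsf{w},\ \omega/\mathsf{w}+c_1\gamma+c_2\}\le 1$, where $\gamma:=\sqrt{d_{\max}/d_{\min}}$. If the depth $m$ fails to satisfy $$m\ge\frac{\tau(v,u)}{4c_2}+\frac{|\mathsf{E}|}{\sqrt{d_vd_u}}\left(\frac{\mathsf{mix}_{y_{\mathsf{G}}}(v,u)}{\gamma\mu}-\frac{1}{c_2}\left(\frac{\gamma+|1-c_2\lambda^*|^{r-1}}{\lambda_1}+2\frac{c^{(2)}}{\mu}\right)\right),$$ where $r=d_{\mathsf{G}}(v,u)$, $\mu=1+2c^{(2)}(1+\gamma)$ and $|1-c_2\lambda^*|=\max_{0<\ell\le n-1}|1-c_2\lambda_\ell|$, then the MPNN cannot learn functions with mixing $\mathsf{mix}_{y_{\mathsf{G}}}(v,u)$; that is, the output function $y^{(m)}_{\mathsf{G}}$ of the MPNN is not equal to any twice differentiable function whose mixing of $v,u$ equals $\mathsf{mix}_{y_{\mathsf{G}}}(v,u)$.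
   Context: Graph: $\mathsf{G}=(\mathsf{V},\mathsf{E})$ is a fixed undirected, connected, non-bipartite graph with $n$ nodes, adjacency matrix $\mathbf{A}$, degrees $d_v$, diagonal degree matrix $\mathbf{D}$, maximal and minimal degrees $d_{\max},d_{\min}$; $d_{\mathsf{G}}$ is the shortest-path distance. $0=\lambda_0<\lambda_1\le\dots\le\lambda_{n-1}$ are the eigenvalues of the normalized Laplacian $\mathbf{I}-\mathbf{D}^{-1/2}\mathbf{A}\mathbf{D}^{-1/2}$. $\tau(v,u)$ is the commute time: the expected number of steps for a simple random walk on $\mathsf{G}$ started at $v$ to reach $u$ and return to $v$. MPNN: each node $v$ carries a feature $\mathbf{x}_v\in\mathbb{R}^d$; $\mathbf{X}\in\mathbb{R}^{n\times d}$ is the feature matrix. With message-passing matrix $\mathsf{A}\in\mathbb{R}^{n\times n}$, for $1\le t\le m$ the layer is $$\mathbf{h}_v^{(t)}=\sigma\Big(\boldsymbol{\Omega}^{(t)}\mathbf{h}_v^{(t-1)}+\mathbf{W}^{(t)}\sum_u\mathsf{A}_{vu}\,\psi^{(t)}(\mathbf{h}_v^{(t-1)},\mathbf{h}_u^{(t-1)})\Big),\qquad \mathbf{h}_v^{(0)}=\mathbf{x}_v,$$ with $\sigma:\mathbb{R}\to\mathbb{R}$ acting entrywise, $\boldsymbol{\Omega}^{(t)},\mathbf{W}^{(t)}\in\mathbb{R}^{d\times d}$, $\psi^{(t)}:\mathbb{R}^d\times\mathbb{R}^d\to\mathbb{R}^d$; the output is $y^{(m)}_{\mathsf{G}}(\mathbf{X})=\boldsymbol{\theta}^\top\mathsf{READ}(\{\mathbf{h}_v^{(m)}\})$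 with $\boldsymbol{\theta}$ a unit vector and $\mathsf{READ}$ entrywise $\mathsf{MAX}$, $\mathsf{MEAN}$ or $\mathsf{SUM}$ over nodes. Standing assumptions: $\sigma$ and $\psi^{(t)}$ are $\mathcal{C}^2$, $|\sigma'|,|\sigma''|\le 1$, and for all $t$: $\|\boldsymbol{\Omega}^{(t)}\|\le\omega$, $\|\mathbf{W}^{(t)}\|\le\mathsf{w}$, $\|\nabla_1\psi^{(t)}\|\le c_1$, $\|\nabla_2\psi^{(t)}\|\le c_2$, $\|\nabla^2\psi^{(t)}\|\le c^{(2)}$, where $\mathsf{w},c_2>0$, $\|\cdot\|$ is the operator norm, $\nabla_a\psi$ is the Jacobian in the $a$-th variable, and $\nabla^2\psi$ is the Hessian of $\psi$ arranged as a $2\times 2$ block matrix with blocks $\nabla^2_{ab}\psi\in\mathbb{R}^{d\times d^2}$, $(\nabla^2_{ab}\psi)_{r,d(\beta-1)+\gamma}=\partial_{a,\beta}\partial_{b,\gamma}\psi^r$. Mixing: for a twice differentiable $y:\mathbb{R}^{n\times d}\to\mathbb{R}$, $\mathsf{mix}_y(v,u)=\max_{\mathbf{X}}\max_{1\le\alpha,\beta\le d}|\partial^2y(\mathbf{X})/\partial x_v^\alpha\partial x_u^\beta|$. Here $y_{\mathsf{G}}:\mathbb{R}^{n\times d}\to\mathbb{R}$ is a twice differentiable target function. *)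

(* Defs.v *)
From HB Require Import structures.
From mathcomp Require Import all_boot all_order all_algebra.
From mathcomp Require Import all_classical all_reals all_analysis.

Set Implicit Arguments.
Unset Strict Implicit.
Unset Printing Implicit Defensive.

Import Order.TTheory GRing.Theory Num.Theory.
Import numFieldNormedType.Exports.

Local Open Scope classical_set_scope.
Local Open Scope ring_scope.

Section Graph.
Variables (n : nat) (e : rel 'I_n).

Definition simple_graph : Prop := symmetric e /\ irreflexive e.

Definition connected_graph : Prop := forall x y, connect e x y.

Definition bipartite : Prop :=
  exists c : 'I_n -> bool, forall x y, e x y -> c x != c y.

Definition deg (x : 'I_n) : nat := #|[set y | e x y]%SET|.

Definition deg_max : nat := (\max_(x < n) deg x)%N.

(* Every degree is at most n, so the default value n never changes the
   minimum. *)
Definition deg_min : nat := \big[minn/n]_(x < n) deg x.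

(* Each undirected edge is counted once, through its increasing orientation. *)
Definition num_edges : nat :=
  #|[set p : 'I_n * 'I_n | (p.1 < p.2)%N && e p.1 p.2]%SET|.

(* In a connected graph on n nodes some walk of length less than n joins
   x to y; [find] returns the least length of such a walk. *)
Definition graph_dist (x y : 'I_n) : nat :=
  find (fun k => [exists p : k.-tuple 'I_n, path e x p && (last x p == y)])
       (iota 0 n).

End Graph.

Section GraphMatrices.
Variables (R : realType) (n : nat) (e : rel 'I_n).

Definition adj_mx : 'M[R]_n := \matrix_(i, j) (e i j)%:R.

(* D^{-1/2} *)
Definition deg_rsqrt : 'M[R]_n :=
  diag_mx (\row_i (Num.sqrt ((deg e i)%:R : R))^-1).

Definition A_sym : 'M[R]_n := deg_rsqrt *m adj_mx *m deg_rsqrt.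

Definition norm_lap : 'M[R]_n := 1%:M - A_sym.

Definition is_spectrum (M : 'M[R]_n) (lam : seq R) : Prop :=
  sorted <=%R lam /\ char_poly M = \prod_(a <- lam) ('X - a%:P).

Definition deg_ratio : R := Num.sqrt ((deg_max e)%:R / (deg_min e)%:R).

End GraphMatrices.

Section CommuteTime.
Variables (R : realType) (n : nat) (e : rel 'I_n).

(* [S] is the simple random walk on the graph started at [v], described by
   the joint law of its first k + 1 positions. *)
Definition simple_random_walk (disp : measure_display)
    (Om : measurableType disp) (P : probability Om R)
    (S : nat -> Om -> 'I_n) (v : 'I_n) : Prop :=
  (forall t x, measurable (S t @^-1` [set x])) /\
  (forall (k : nat) (x : nat -> 'I_n),
    P [set w | forall i : nat, (i <= k)%N -> S i w = x i] =
    ((x 0%N == v)%:R *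
     \prod_(i < k) ((e (x i) (x i.+1))%:R / (deg e (x i))%:R))%:E).

(* Number of steps made by the trajectory [s], started at [v], until it has
   visited [u] and is back at [v]; +oo if that never happens, 0 if v = u. *)
Definition commute_steps (v u : 'I_n) (s : nat -> 'I_n) : \bar R :=
  ereal_inf [set (k%:R)%:E | k in
    [set k : nat | s k = v /\ exists2 j : nat, (j <= k)%N & s j = u]].

Definition commute_time (disp : measure_display) (Om : measurableType disp)
    (P : probability Om R) (S : nat -> Om -> 'I_n) (v u : 'I_n) : \bar R :=
  (\int[P]_w commute_steps v u (fun t => S t w))%E.

End CommuteTime.

Section Smoothness.
Variables (R : realType) (U V : normedModType R).

(* For finite-dimensional [U], [f] is differentiable and so is its
   differential. *)
Definition twice_differentiable (f : U -> V) : Prop :=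
  (forall x, differentiable f x) /\
  (forall a x, differentiable ('D_a f) x).

Definition is_C2 (f : U -> V) : Prop :=
  twice_differentiable f /\ (forall a b, continuous ('D_a ('D_b f))).

End Smoothness.

Section Norms.
Variable R : realType.

Definition norm2 (k : nat) (x : 'cV[R]_k) : R :=
  Num.sqrt (\sum_i x i 0 ^+ 2).

Definition opnorm (k l : nat) (M : 'M[R]_(k, l)) : R :=
  sup [set norm2 (M *m x) | x in [set x : 'cV[R]_l | norm2 x <= 1]].

End Norms.

Section Derivatives.
Variables (R : realType) (d : nat).

Definition basis_vec (b : 'I_d) : 'cV[R]_d := delta_mx b 0.

(* The direction of the [b]-th coordinate of the first ([a = false]) or
   second ([a = true]) argument. *)
Definition arg_dir (a : bool) (b : 'I_d) : ('cV[R]_d * 'cV[R]_d)%type :=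
  if a then (0, basis_vec b) else (basis_vec b, 0).

Variable psi : 'cV[R]_d -> 'cV[R]_d -> 'cV[R]_d.

Definition psi2 (p : 'cV[R]_d * 'cV[R]_d) : 'cV[R]_d := psi p.1 p.2.

Definition psi_jac (a : bool) (p : 'cV[R]_d * 'cV[R]_d) : 'M[R]_d :=
  \matrix_(r, b) ('D_(arg_dir a b) psi2 p) r 0.

(* [mxvec] puts the entry (b, c) in column d * b + c (from 0). *)
Definition psi_hess_block (a1 a2 : bool) (p : 'cV[R]_d * 'cV[R]_d) :
    'M[R]_(d, d * d) :=
  \matrix_(r, k) mxvec (\matrix_(b, c)
    ('D_(arg_dir a1 b) ('D_(arg_dir a2 c) psi2) p) r 0) 0 k.

Definition psi_hess (p : 'cV[R]_d * 'cV[R]_d) :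
    'M[R]_(d + d, d * d + d * d) :=
  block_mx (psi_hess_block false false p) (psi_hess_block false true p)
           (psi_hess_block true false p) (psi_hess_block true true p).

End Derivatives.

Inductive readout : Set := READ_MAX | READ_MEAN | READ_SUM.

(* The layers are numbered from 1; the entries at index 0 are unused. *)
Record mpnn (R : realType) (d : nat) := Mpnn {
  act : R -> R;
  res_mx : nat -> 'M[R]_d;
  msg_mx : nat -> 'M[R]_d;
  msg_fun : nat -> 'cV[R]_d -> 'cV[R]_d -> 'cV[R]_d;
  read : readout;
  out_vec : 'cV[R]_d
}.

Section MPNN.
Variables (R : realType) (n d : nat) (N : mpnn R d) (A : 'M[R]_n).

(* Row v of the feature matrix X is the feature of node v. *)
Fixpoint hidden (t : nat) (X : 'M[R]_(n, d)) (v : 'I_n) : 'cV[R]_d :=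
  if t is t'.+1 then
    map_mx (act N)
      (res_mx N t *m hidden t' X v +
       msg_mx N t *m
         (\sum_u A v u *: msg_fun N t (hidden t' X v) (hidden t' X u)))
  else (row v X)^T.

Definition read_apply (k : readout) (h : 'I_n -> 'cV[R]_d) : 'cV[R]_d :=
  \col_i match k with
         | READ_MAX => sup (range (fun v => h v i 0))
         | READ_MEAN => (\sum_v h v i 0) / n%:R
         | READ_SUM => \sum_v h v i 0
         end.

Definition mpnn_output (m : nat) (X : 'M[R]_(n, d)) : R :=
  \sum_i out_vec N i 0 * read_apply (read N) (hidden m X) i 0.

End MPNN.

Record mpnn_bounds (R : realType) (d m : nat) (N : mpnn R d)
    (omega w c1 c2 cH : R) : Prop := MpnnBounds {
  act_C2 : is_C2 (act N);
  act_d1 : forall x, `|derive1 (act N) x| <= 1;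
  act_d2 : forall x, `|derive1 (derive1 (act N)) x| <= 1;
  out_unit : norm2 (out_vec N) = 1;
  msg_C2 : forall t, (1 <= t <= m)%N -> is_C2 (psi2 (msg_fun N t));
  res_le : forall t, (1 <= t <= m)%N -> opnorm (res_mx N t) <= omega;
  msg_le : forall t, (1 <= t <= m)%N -> opnorm (msg_mx N t) <= w;
  jac1_le : forall t, (1 <= t <= m)%N ->
    forall p, opnorm (psi_jac (msg_fun N t) false p) <= c1;
  jac2_le : forall t, (1 <= t <= m)%N ->
    forall p, opnorm (psi_jac (msg_fun N t) true p) <= c2;
  hess_le : forall t, (1 <= t <= m)%N ->
    forall p, opnorm (psi_hess (msg_fun N t) p) <= cH;
  omega_ge0 : 0 <= omega;
  w_gt0 : 0 < w;
  c1_ge0 : 0 <= c1;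
  c2_gt0 : 0 < c2;
  cH_ge0 : 0 <= cH
}.

(* The supremum (possibly +oo) stands for the maximum over X. *)
Definition mixing (R : realType) (n d : nat) (y : 'M[R]_(n, d) -> R)
    (v u : 'I_n) : \bar R :=
  ereal_sup [set z : \bar R | exists (X : 'M[R]_(n, d)) (a b : 'I_d),
    z = (`|'D_(delta_mx v a) ('D_(delta_mx u b) y) X|)%:E].

(* Main.v *)
(* Write T = (1 - c2) I + c2 A_sym = I - c2 L, with L the normalized Laplacian.
   Since A_sym has row sums at most gamma, the smallness hypothesis makes the
   Jacobian norms of the hidden features at layer t at most the entries of T^t,
   and the chain rule gives a linear recursion for the norms of the mixed
   second derivatives. Weighting the nodes by sqrt (deg i), a fixed vector of T,
   bounds the mixing by gamma times the (v, u) entry of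
     sum_(1 <= t <= m) T^(2t) + 2 cH sum_(t < m) (gamma I + A_sym) T^(2t).
   As T has nonnegative entries, each of these sums over even powers is at most
   a sum over 2m consecutive powers, which is geometric on the eigenvectors of
   L. Its constant term is m sqrt (d_v d_u) / |E| and its leading correction is
   the (v, u) entry of the pseudo-inverse of L, in which the commute time
   appears. Only an upper bound on the commute time is needed; it follows from
   the supermartingale property of the hitting-time function. READ_MAX is not
   differentiable, but a twice differentiable selection of finitely many twice
   differentiable functions has at each point the same mixed derivative as one
   of them. *)

Require Import Defs.
From HB Require Import structures.
From mathcomp Require Import all_boot all_order all_algebra.
From mathcomp Require Import all_classical all_reals all_analysis.
From mathcomp Require Import measurable_realfun ring lra.

Set Implicit Arguments.
Unset Strict Implicit.
Unset Printing Implicit Defensive.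

Import Order.TTheory GRing.Theory Num.Theory.
Import numFieldNormedType.Exports.

Local Open Scope classical_set_scope.
Local Open Scope ring_scope.

(** * Second directional derivatives of composites *)

Section Jets.
Variable R : realType.
Implicit Types U V W : normedModType R.

(** Put a = sqrt (d_v d_u) / |E| and q = rho^(r - 1), rho being the largest |1 - c2 lam_l| with l >
    0. The sums of T^(2t) over 1 <= t <= m and over t < m have their (v, u) entry bounded by the
    same B = m a + (gamma + q) / (c2 lam_1) - tau a / (4 c2); the sum of A_sym T^(2t) exceeds it by
    at most 1 / c2. Hence the mixing is at most gamma (mu B + 2 cH / c2), and the stated inequality
    is this one solved for m. The outer gamma is the price of replacing the weights sqrt (deg i) by
    1; the gamma inside mu comes from the row sums of A_sym. The exponent r - 1 reflects that the
    entry of T^k vanishes for k < r: either 2m < r and B >= 0 suffices, or the geometric remainder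
    can be compared with q. The delicate sum is the one over 1 <= t <= m: its range is shifted
    against the others, which seems to cost an extra a / 2. To recover it, the estimates of the
    pseudo-inverse keep the deficit a / 2 left by removing the ground state. *)

Lemma is_derive_finsum U W (I : finType) (F : I -> U -> W) (dF : I -> W) x v :
  (forall i, is_derive x v (F i) (dF i)) ->
  is_derive x v (fun y => \sum_i F i y) (\sum_i dF i).
Proof.
move=> FP; have -> : (fun y => \sum_i F i y) =
    \sum_(k < #|I|) F (enum_val k).
  by apply/funext => y; rewrite fct_sumE (reindex _ (onW_bij _ (enum_val_bij I))).
rewrite (reindex _ (onW_bij _ (enum_val_bij I))).
by apply: is_derive_sum => k.
Qed.

Lemma differentiable_finsum U W (I : finType) (F : I -> U -> W) x :
  (forall i, differentiable (F i) x) ->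
  differentiable (fun y => \sum_i F i y) x.
Proof.
move=> FP; have -> : (fun y => \sum_i F i y) =
    \sum_(k < #|I|) F (enum_val k).
  by apply/funext => y; rewrite fct_sumE (reindex _ (onW_bij _ (enum_val_bij I))).
by apply: differentiable_sum => k.
Qed.

Lemma derive_finsum U W (I : finType) (F : I -> U -> W) x v :
  (forall i, derivable (F i) x v) ->
  'D_v (fun y => \sum_i F i y) x = \sum_i 'D_v (F i) x.
Proof.
move=> FP; have FP' i := derivableP (FP i).
by have [] := is_derive_finsum FP'.
Qed.

Lemma derive_comp U V W (f : U -> V) (g : V -> W) x v :
  differentiable f x -> differentiable g (f x) ->
  'D_v (g \o f) x = 'D_('D_v f x) g (f x).
Proof.
move=> df dg; rewrite (deriveE _ (differentiable_comp df dg)) diff_comp //=.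
by rewrite (deriveE _ dg) (deriveE _ df).
Qed.

Lemma derive_expand V W (I : finType) (g : V -> W) (e : I -> V) (c : I -> R) y :
  differentiable g y ->
  'D_(\sum_i c i *: e i) g y = \sum_i c i *: 'D_(e i) g y.
Proof.
move=> dg; rewrite deriveE // linear_sum; apply: eq_bigr => i _.
by rewrite linearZ /= deriveE.
Qed.

Variables (U V : normedModType R) (I : finType) (e : I -> V) (F : I -> U -> R).
Hypothesis F2 : forall i, twice_differentiable (F i : U -> R).
(** Scalar coordinates along fixed vectors: differentiating [g] after [f] then only produces
    derivatives of [g] in the fixed directions [e i], the ones whose differentiability
    [twice_differentiable] provides. With a general inner map the direction would move with the
    point. *)
Let f y := \sum_i F i y *: e i.

Lemma differentiable_span x : differentiable f x.
Proof.
apply: differentiable_finsum => i; apply: differentiableZl.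
by have [] := F2 i.
Qed.

Lemma derive_span x v : 'D_v f x = \sum_i 'D_v (F i) x *: e i.
Proof.
have fE i : differentiable (fun y => F i y *: e i) x.
  by apply: differentiableZl; have [] := F2 i.
rewrite derive_finsum; last by move=> i; apply: diff_derivable.
apply: eq_bigr => i _; rewrite deriveE // diffZl; last by have [] := F2 i.
by rewrite deriveE //; have [] := F2 i.
Qed.

Variable g : V -> R.
Hypothesis g2 : twice_differentiable g.

Lemma derive_comp_span (k : V -> R) x v :
  (forall y, differentiable k y) ->
  'D_v (fun y => k (f y)) x = \sum_i 'D_v (F i) x * 'D_(e i) k (f x).
Proof.
move=> dk; rewrite (_ : (fun y => _) = k \o f) // derive_comp //; last first.
  exact: differentiable_span.
by rewrite derive_span derive_expand.
Qed.

Lemma differentiable_comp_span (k : V -> R) x :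
  (forall y, differentiable k y) -> differentiable (fun y => k (f y)) x.
Proof.
move=> dk; apply: (@differentiable_comp _ _ _ _ f k) => //.
exact: differentiable_span.
Qed.

Let term v i y := 'D_v (F i) y * 'D_(e i) g (f y).

Let termE v : 'D_v (fun y => g (f y)) = fun y => \sum_i term v i y.
Proof.
by apply/funext => x; rewrite derive_comp_span //; have [] := g2.
Qed.

Let differentiable_term v i x : differentiable (term v i) x.
Proof.
apply: differentiableM; first by have [_] := F2 i; apply.
by apply: (differentiable_comp_span (k := 'D_(e i) g)) => y; have [_] := g2; apply.
Qed.

Lemma twice_differentiable_comp_span :
  twice_differentiable ((fun y => g (f y)) : U -> R).
Proof.
split=> [x|v x].
  by apply: (differentiable_comp_span (k := g)); have [] := g2.
by rewrite termE; apply: differentiable_finsum => i.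
Qed.

Lemma derive2_comp_span x a b :
  'D_a ('D_b (fun y => g (f y))) x =
  \sum_i 'D_a ('D_b (F i)) x * 'D_(e i) g (f x) +
  \sum_i \sum_j 'D_b (F i) x * 'D_a (F j) x * 'D_(e j) ('D_(e i) g) (f x).
Proof.
rewrite termE derive_finsum; last first.
  by move=> i; apply: diff_derivable; apply: differentiable_term.
rewrite -big_split /=; apply: eq_bigr => i _.
have d1 : derivable ('D_b (F i)) x a.
  by apply: diff_derivable; have [_] := F2 i; apply.
have dg y : differentiable ('D_(e i) g) y by have [_] := g2; apply.
have d2 : derivable (fun y => 'D_(e i) g (f y)) x a.
  by apply: diff_derivable; apply: (differentiable_comp_span (k := 'D_(e i) g)).
have -> : 'D_a (term b i) x = 'D_b (F i) x * 'D_a (fun y => 'D_(e i) g (f y)) x +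
    'D_(e i) g (f x) * 'D_a ('D_b (F i)) x by exact: (deriveM d1 d2).
rewrite (derive_comp_span _ _ dg) addrC; congr (_ + _); last exact: mulrC.
by rewrite mulr_sumr; apply: eq_bigr => j _; rewrite mulrA.
Qed.

End Jets.

Section TwiceDifferentiable.
Variables (R : realType) (U : normedModType R).

Lemma derive_lincomb (I : finType) (c : I -> R) (F : I -> U -> R) x v :
  (forall i, differentiable (F i) x) ->
  'D_v (fun y => \sum_i c i * F i y) x = \sum_i c i * 'D_v (F i) x.
Proof.
move=> dF; have dcF i : derivable (c i *: F i) x v.
  by apply: derivableZ; apply: diff_derivable.
rewrite (_ : (fun y => _) = fun y => \sum_i (c i *: F i) y) //.
rewrite derive_finsum //; apply: eq_bigr => i _.
exact: (deriveZ _ (diff_derivable (dF i))).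
Qed.

Lemma differentiable_lincomb (I : finType) (c : I -> R) (F : I -> U -> R) x :
  (forall i, differentiable (F i) x) ->
  differentiable (fun y => \sum_i c i * F i y) x.
Proof.
move=> dF; apply: differentiable_finsum => i.
exact: (differentiableZ (c i) (dF i)).
Qed.

Variables (I : finType) (c : I -> R) (F : I -> U -> R).
Hypothesis F2 : forall i, twice_differentiable (F i : U -> R).

Let derive_lincombE v :
  'D_v (fun y => \sum_i c i * F i y) = fun x => \sum_i c i * 'D_v (F i) x.
Proof.
by apply/funext => x; rewrite derive_lincomb // => i; have [] := F2 i.
Qed.

Lemma twice_differentiable_lincomb :
  twice_differentiable ((fun y => \sum_i c i * F i y) : U -> R).
Proof.
split=> [x|v x].
  by apply: differentiable_lincomb => i; have [] := F2 i.
rewrite derive_lincombE; apply: differentiable_lincomb => i.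
by have [_] := F2 i; apply.
Qed.

Lemma derive2_lincomb a b x :
  'D_a ('D_b (fun y => \sum_i c i * F i y)) x =
  \sum_i c i * 'D_a ('D_b (F i)) x.
Proof.
rewrite derive_lincombE derive_lincomb // => i.
by have [_] := F2 i; apply.
Qed.

End TwiceDifferentiable.

(** * Selections from finitely many smooth branches *)

Section Selection.
Variables (R : realType) (U : normedModType R) (J : finType).

(* By pigeonhole, one branch [g j] agrees with [f] at points x + h v with h
   arbitrarily small, so that both the values and the difference quotients
   have the same limit. *)
Lemma derive_selection (f : U -> R) (g : J -> U -> R) x v :
  derivable f x v -> (forall j, derivable (g j) x v) ->
  (forall y, exists j, f y = g j y) ->
  exists2 j, f x = g j x & 'D_v f x = 'D_v (g j) x.
Proof.
move=> df dg sel.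
have [j jP] : exists j, forall A : set R, 0^' A ->
    exists2 h, A h & f (h *: v + x) = g j (h *: v + x).
  apply/not_existsP => nj.
  have {}nj j : 0^' [set h | f (h *: v + x) <> g j (h *: v + x)].
    have /existsNP[A /not_implyP[A0 nA]] := nj j.
    apply: filterS A0 => h Ah E; apply: nA; exists h => //.
  have /filter_ex[h hP] : \forall h \near (0 : R)^',
      forall j, f (h *: v + x) <> g j (h *: v + x) by exact: filter_forall.
  by have [j E] := sel (h *: v + x); exact: (hP j).
pose k y := f y - g j y.
have dk : derivable k x v by exact: (derivableB df (dg j)).
have kE : 'D_v k x = 'D_v f x - 'D_v (g j) x by exact: (deriveB df (dg j)).
have kfreq (A : set R) : 0^' A -> exists2 h, A h & k (h *: v + x) = 0.
  by move=> /jP[h Ah E]; exists h => //; rewrite /k E subrr.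
have quot : h^-1 *: (k (h *: v + x) - k x) @[h --> 0^'] --> 'D_v k x by [].
have kx : k x = 0.
  (* Along [v] the increment is h times the difference quotient, so it tends to 0; yet for h
     arbitrarily small it equals - k x. *)
  have : k (h *: v + x) - k x @[h --> 0^'] --> (0 : R).
    have idc : h @[h --> (0 : R)^'] --> (0 : R).
      exact: (@nbhs_dnbhs _ (0 : R)).
    have H := cvgM idc quot; rewrite mul0r in H.
    suff -> : (fun h : R => k (h *: v + x) - k x) =
        (fun h => h * (h^-1 *: (k (h *: v + x) - k x))) by exact: H.
    apply/funext => h.
    have [->|h0] := eqVneq h 0; first by rewrite mul0r scale0r add0r subrr.
    by rewrite /GRing.scale /= mulrA divff // mul1r.
  move=> kc; apply/eqP; rewrite -normr_le0; apply/ler_addgt0Pl => eps eps0.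
  rewrite addr0.
  have /cvgrPdist_lt/(_ _ eps0)/kfreq [h /= + E] := kc.
  by rewrite E !sub0r opprK => /ltW.
exists j; first by apply/eqP; rewrite -subr_eq0 -/(k x) kx.
apply/eqP; rewrite -subr_eq0 -kE -normr_le0; apply/ler_addgt0Pl => eps eps0.
rewrite addr0.
have /cvgrPdist_lt/(_ _ eps0)/kfreq [h /= + E] := quot.
by rewrite E kx subrr scaler0 subr0 => /ltW.
Qed.

(** The first-order statement, used at every point, makes 'D_b f a selection of the functions 'D_b
    (g j), to which it applies once more. *)
Lemma derive2_selection (f : U -> R) (g : J -> U -> R) x a b :
  twice_differentiable f -> (forall j, twice_differentiable (g j)) ->
  (forall y, exists j, f y = g j y) ->
  exists j, 'D_a ('D_b f) x = 'D_a ('D_b (g j)) x.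
Proof.
move=> [df d2f] g2 sel.
have [||y|j _ ->] := @derive_selection ('D_b f) (fun j => 'D_b (g j)) x a.
- exact: diff_derivable.
- by move=> j; apply: diff_derivable; have [_] := g2 j; apply.
- have [||//|j _ E] := @derive_selection f g y b; last by exists j.
    exact: diff_derivable.
  by move=> j; apply: diff_derivable; have [] := g2 j.
by exists j.
Qed.

End Selection.

(** * Euclidean and operator norms *)

Section Norm2.
Variable R : realType.

Lemma norm2_ge0 k (x : 'cV[R]_k) : 0 <= norm2 x.
Proof. exact: sqrtr_ge0. Qed.

Lemma sqr_norm2 k (x : 'cV[R]_k) : norm2 x ^+ 2 = \sum_i x i 0 ^+ 2.
Proof. by rewrite sqr_sqrtr // sumr_ge0 // => i _; apply: sqr_ge0. Qed.

Lemma norm2_le_sqr k (x : 'cV[R]_k) (c : R) :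
  0 <= c -> \sum_i x i 0 ^+ 2 <= c ^+ 2 -> norm2 x <= c.
Proof.
by move=> c0; rewrite -sqr_norm2 ler_sqr // nnegrE norm2_ge0.
Qed.

Lemma normr_entry_le_norm2 k (x : 'cV[R]_k) i : `|x i 0| <= norm2 x.
Proof.
rewrite -ler_sqr ?nnegrE ?norm2_ge0 // sqr_norm2 real_normK ?num_real //.
by rewrite (bigD1 i) //= lerDl sumr_ge0 // => j _; apply: sqr_ge0.
Qed.

Lemma norm2_mono k (x y : 'cV[R]_k) :
  (forall i, `|x i 0| <= `|y i 0|) -> norm2 x <= norm2 y.
Proof.
move=> xy; apply: norm2_le_sqr; first exact: norm2_ge0.
rewrite sqr_norm2; apply: ler_sum => i _.
by rewrite -(real_normK (num_real (x i 0))) -(real_normK (num_real (y i 0))) ler_sqr ?nnegrE.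
Qed.

Lemma norm20 k : norm2 (0 : 'cV[R]_k) = 0.
Proof. by rewrite /norm2 big1 ?sqrtr0 // => i _; rewrite mxE expr0n. Qed.

Lemma norm2_eq0 k (x : 'cV[R]_k) : norm2 x = 0 -> x = 0.
Proof.
move=> x0; apply/matrixP => i j; rewrite ord1 mxE; apply/eqP.
by rewrite -normr_le0 -x0 normr_entry_le_norm2.
Qed.

Lemma norm2Z k (c : R) (x : 'cV[R]_k) : norm2 (c *: x) = `|c| * norm2 x.
Proof.
rewrite /norm2 (eq_bigr (fun i => c ^+ 2 * x i 0 ^+ 2)); last first.
  by move=> i _; rewrite mxE exprMn.
by rewrite -mulr_sumr sqrtrM ?sqr_ge0 // sqrtr_sqr.
Qed.

Lemma cauchy_schwarz k (x y : 'cV[R]_k) :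
  \sum_i x i 0 * y i 0 <= norm2 x * norm2 y.
Proof.
have [x0|x0] := eqVneq (norm2 x) 0.
  by rewrite x0 mul0r big1 // => i _; rewrite (norm2_eq0 x0) mxE mul0r.
have [y0|y0] := eqVneq (norm2 y) 0.
  by rewrite y0 mulr0 big1 // => i _; rewrite (norm2_eq0 y0) mxE mulr0.
set A := norm2 x in x0 *; set B := norm2 y in y0 *.
have AB : 0 < A * B by rewrite mulr_gt0 // lt0r ?x0 ?y0 norm2_ge0.
have : 0 <= \sum_i (B * x i 0 - A * y i 0) ^+ 2.
  by apply: sumr_ge0 => i _; apply: sqr_ge0.
rewrite (eq_bigr (fun i => B ^+ 2 * x i 0 ^+ 2 + A ^+ 2 * y i 0 ^+ 2
    - (A * B * 2) * (x i 0 * y i 0))); last by move=> i _; ring.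
rewrite sumrB big_split /= -!mulr_sumr -!sqr_norm2 -/A -/B => H.
by rewrite -(ler_pM2l AB); nra.
Qed.

Lemma norm2D k (x y : 'cV[R]_k) : norm2 (x + y) <= norm2 x + norm2 y.
Proof.
apply: norm2_le_sqr; first by rewrite addr_ge0 ?norm2_ge0.
rewrite sqrrD !sqr_norm2 (eq_bigr (fun i => x i 0 ^+ 2 +
   2 * (x i 0 * y i 0) + y i 0 ^+ 2)); last by move=> i _; rewrite mxE; ring.
rewrite !big_split /= lerD2r lerD2l -mulr_sumr mulr2n -mulr2n -mulr_natl.
by rewrite ler_wpM2l // cauchy_schwarz.
Qed.

Lemma norm2_sum k (I : finType) (F : I -> 'cV[R]_k) :
  norm2 (\sum_i F i) <= \sum_i norm2 (F i).
Proof.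
elim/big_ind2 : _ => // [|x a y b xa yb]; first by rewrite norm20.
by apply: le_trans (norm2D _ _) _; apply: lerD.
Qed.

Lemma norm2_hadamard k (x y : 'cV[R]_k) :
  norm2 (\col_i (x i 0 * y i 0)) <= norm2 x * norm2 y.
Proof.
rewrite -(ger0_norm (norm2_ge0 x)) -norm2Z; apply: norm2_mono => i.
by rewrite !mxE !normrM ler_wpM2r // (ger0_norm (norm2_ge0 x)) normr_entry_le_norm2.
Qed.

(** A Hessian acts on vectorised outer products of gradients. These have norm exactly the product of
    the norms, so the operator-norm bound on the Hessian costs no dimension factor. *)
Lemma norm2_outer k (x y : 'cV[R]_k) :
  norm2 (mxvec (\matrix_(i, j) (x i 0 * y j 0)))^T = norm2 x * norm2 y.
Proof.
rewrite -[RHS]ger0_norm ?mulr_ge0 ?norm2_ge0 // -sqrtr_sqr; congr Num.sqrt.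
rewrite exprMn !sqr_norm2 (reindex _ (curry_mxvec_bij k k)) /= mulr_suml.
rewrite (eq_bigr (fun p => (x p.1 0 * y p.2 0) ^+ 2)); last first.
  by case=> i j _; rewrite mxE mxvecE mxE.
rewrite -(pair_bigA _ (fun i j => (x i 0 * y j 0) ^+ 2)) /=.
apply: eq_bigr => i _; rewrite mulr_sumr; apply: eq_bigr => j _.
by rewrite exprMn.
Qed.

(** A crude bound, there to show that the set in [opnorm] is bounded above, so that its [sup] is a
    genuine supremum. *)
Lemma norm2_mulmx_ub k l (M : 'M[R]_(k, l)) (x : 'cV[R]_l) :
  norm2 (M *m x) <= (\sum_j norm2 (col j M)) * norm2 x.
Proof.
have -> : M *m x = \sum_j x j 0 *: col j M.
  apply/colP => i; rewrite mxE summxE; apply: eq_bigr => j _.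
  by rewrite !mxE mulrC.
apply: le_trans (norm2_sum _) _; rewrite mulr_suml; apply: ler_sum => j _.
by rewrite norm2Z mulrC ler_wpM2l ?norm2_ge0 // normr_entry_le_norm2.
Qed.

Lemma norm2_mulmx k l (M : 'M[R]_(k, l)) (x : 'cV[R]_l) :
  norm2 (M *m x) <= opnorm M * norm2 x.
Proof.
have [x0|x0] := eqVneq (norm2 x) 0.
  by rewrite (norm2_eq0 x0) mulmx0 !norm20 mulr0.
have x_gt0 : 0 < norm2 x by rewrite lt0r x0 norm2_ge0.
rewrite -ler_pdivrMr // mulrC.
have -> : (norm2 x)^-1 * norm2 (M *m x) = norm2 (M *m ((norm2 x)^-1 *: x)).
  by rewrite -scalemxAr norm2Z ger0_norm // invr_ge0 norm2_ge0.
apply: ub_le_sup.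
  exists (\sum_j norm2 (col j M)) => _ [y /= y1 <-].
  apply: le_trans (norm2_mulmx_ub M y) _.
  by rewrite ler_piMr // sumr_ge0 // => j _; apply: norm2_ge0.
exists ((norm2 x)^-1 *: x) => //=.
by rewrite norm2Z ger0_norm ?invr_ge0 ?norm2_ge0 // mulVf.
Qed.

Lemma norm2_mulmx_le k l (M : 'M[R]_(k, l)) (x : 'cV[R]_l) c :
  opnorm M <= c -> norm2 (M *m x) <= c * norm2 x.
Proof.
move=> Mc; apply: le_trans (norm2_mulmx M x) _.
by rewrite ler_wpM2r ?norm2_ge0.
Qed.

Lemma norm2_col_mx k l (x : 'cV[R]_k) (y : 'cV[R]_l) :
  norm2 (col_mx x y) = Num.sqrt (norm2 x ^+ 2 + norm2 y ^+ 2).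
Proof.
rewrite !sqr_norm2 /norm2 big_split_ord /=; congr (Num.sqrt (_ + _)).
  by apply: eq_bigr => i _; rewrite col_mxEu.
by apply: eq_bigr => i _; rewrite col_mxEd.
Qed.

Lemma norm2_col_mxl k l (x : 'cV[R]_k) (y : 'cV[R]_l) :
  norm2 x <= norm2 (col_mx x y).
Proof.
rewrite norm2_col_mx -{1}(ger0_norm (norm2_ge0 x)) -sqrtr_sqr.
by rewrite ler_wsqrtr // lerDl sqr_ge0.
Qed.

Lemma norm2_col_mxr k l (x : 'cV[R]_k) (y : 'cV[R]_l) :
  norm2 y <= norm2 (col_mx x y).
Proof.
rewrite norm2_col_mx -{1}(ger0_norm (norm2_ge0 y)) -sqrtr_sqr.
by rewrite ler_wsqrtr // lerDr sqr_ge0.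
Qed.

(** Padding a vector with zeros preserves its norm and projecting the image does not increase it, so
    each block inherits the bound of the whole matrix. *)
Lemma norm2_block_mx k1 k2 l1 l2 (A : 'M[R]_(k1, l1)) (B : 'M[R]_(k1, l2))
    (C : 'M[R]_(k2, l1)) (D : 'M[R]_(k2, l2)) c :
  opnorm (block_mx A B C D) <= c ->
  [/\ forall x, norm2 (A *m x) <= c * norm2 x,
      forall x, norm2 (B *m x) <= c * norm2 x,
      forall x, norm2 (C *m x) <= c * norm2 x &
      forall x, norm2 (D *m x) <= c * norm2 x].
Proof.
move=> Mc.
have left x : norm2 (block_mx A B C D *m col_mx x 0) <= c * norm2 x.
  apply: le_trans (norm2_mulmx_le _ Mc) _.
  by rewrite norm2_col_mx norm20 expr0n addr0 sqrtr_sqr ger0_norm ?norm2_ge0.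
have right x : norm2 (block_mx A B C D *m col_mx 0 x) <= c * norm2 x.
  apply: le_trans (norm2_mulmx_le _ Mc) _.
  by rewrite norm2_col_mx norm20 expr0n add0r sqrtr_sqr ger0_norm ?norm2_ge0.
split=> x.
- apply: le_trans (left x); rewrite mul_block_col !mulmx0 !addr0.
  exact: norm2_col_mxl.
- apply: le_trans (right x); rewrite mul_block_col !mulmx0 !add0r.
  exact: norm2_col_mxl.
- apply: le_trans (left x); rewrite mul_block_col !mulmx0 !addr0.
  exact: norm2_col_mxr.
- apply: le_trans (right x); rewrite mul_block_col !mulmx0 !add0r.
  exact: norm2_col_mxr.
Qed.

End Norm2.

(** * Derivatives of the hidden features *)

Section Coordinates.
Variable R : realType.

Lemma derive_coord (U : normedModType R) k l (f : U -> 'M[R]_(k, l)) i j x v :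
  differentiable f x -> 'D_v (fun y => f y i j) x = ('D_v f x) i j.
Proof. by move=> df; rewrite derive_mx ?mxE //; exact: diff_derivable. Qed.

Lemma differentiable_entry (U : normedModType R) k l (f : U -> 'M[R]_(k, l)) i j x :
  differentiable f x -> differentiable (fun y => f y i j : R) x.
Proof.
move=> df; apply: (@differentiable_comp _ _ _ _ f (fun M => M i j)) => //.
exact: differentiable_coord.
Qed.

Lemma twice_differentiable_entry (U : normedModType R) k l
    (f : U -> 'M[R]_(k, l)) i j :
  twice_differentiable f -> twice_differentiable ((fun y => f y i j) : U -> R).
Proof.
move=> [df d2f]; split=> [x|v x]; first exact: differentiable_entry.
rewrite (_ : 'D_v _ = fun y => ('D_v f y) i j); first exact: differentiable_entry.
by apply/funext => y; rewrite derive_coord.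
Qed.

Lemma derive2_entry (U : normedModType R) k l (f : U -> 'M[R]_(k, l)) i j x a b :
  twice_differentiable f ->
  'D_a ('D_b (fun y => f y i j)) x = ('D_a ('D_b f) x) i j.
Proof.
move=> [df d2f]; rewrite (_ : 'D_b (fun y => f y i j) = fun y => ('D_b f y) i j).
  exact: derive_coord.
by apply/funext => y; rewrite derive_coord.
Qed.

Lemma derive_entry_id k l (X v : 'M[R]_(k, l)) i j :
  'D_v (fun Y : 'M[R]_(k, l) => Y i j) X = v i j.
Proof. by rewrite derive_coord // derive_id. Qed.

Lemma twice_differentiable_coord k l (i : 'I_k) (j : 'I_l) :
  twice_differentiable ((fun Y => Y i j) : 'M[R]_(k, l) -> R).
Proof.
split=> [x|v x]; first exact: differentiable_coord.
rewrite (_ : 'D_v _ = cst (v i j)); first exact: differentiable_cst.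
by apply/funext => y; rewrite derive_entry_id.
Qed.

Lemma derive2_entry_id k l (X a b : 'M[R]_(k, l)) i j :
  'D_a ('D_b (fun Y : 'M[R]_(k, l) => Y i j)) X = 0.
Proof.
rewrite (_ : 'D_b _ = cst (b i j)) ?derive_cst //.
by apply/funext => y; rewrite derive_entry_id.
Qed.

End Coordinates.

Section ScalarChain.
Variables (R : realType) (U : normedModType R) (s : R -> R) (f : U -> R).
Hypotheses (s2 : twice_differentiable s) (f2 : twice_differentiable f).

Let spanE (k : R -> R) :
  (fun y => k (f y)) = fun y => k (\sum_(i < 1) f y *: (1 : R)).
Proof. by apply/funext => y; rewrite big_ord1 /GRing.scale /= mulr1. Qed.

Lemma twice_differentiable_chain :
  twice_differentiable ((fun y => s (f y)) : U -> R).
Proof.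
rewrite spanE.
exact: (twice_differentiable_comp_span (fun _ : 'I_1 => 1 : R) (fun=> f2) s2).
Qed.

Lemma derive_chain x v :
  'D_v (fun y => s (f y)) x = 'D_v f x * derive1 s (f x).
Proof.
have [ds _] := s2.
rewrite spanE (derive_comp_span (fun _ : 'I_1 => 1 : R) (fun=> f2) x v ds).
by rewrite !big_ord1 derive1E /GRing.scale /= mulr1.
Qed.

Lemma derive2_chain x a b :
  'D_a ('D_b (fun y => s (f y))) x =
  'D_a ('D_b f) x * derive1 s (f x) +
  'D_b f x * 'D_a f x * derive1 (derive1 s) (f x).
Proof.
have s'E : derive1 s = 'D_1 s by apply/funext => y; rewrite derive1E.
rewrite spanE (derive2_comp_span (fun _ : 'I_1 => 1 : R) (fun=> f2) s2).
rewrite !big_ord1 !derive1E s'E.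
by rewrite /GRing.scale /= mulr1.
Qed.

End ScalarChain.

Section MessageJets.
Variables (R : realType) (d : nat) (U : normedModType R).
Variables (psi : 'cV[R]_d -> 'cV[R]_d -> 'cV[R]_d) (h : bool -> U -> 'cV[R]_d).
Hypotheses (psi_2 : twice_differentiable (psi2 psi))
  (h_2 : forall s k, twice_differentiable ((fun y => h s y k 0) : U -> R)).

(** Derivatives are taken entry by entry, so that regularity only has to be tracked for scalar
    functions. *)
Definition dvec (f : U -> 'cV[R]_d) b y : 'cV[R]_d :=
  \col_k 'D_b (fun z => f z k 0) y.
Definition d2vec (f : U -> 'cV[R]_d) a b y : 'cV[R]_d :=
  \col_k 'D_a ('D_b (fun z => f z k 0)) y.

(** Brings the two arguments of a message into the form coordinates times fixed directions that the
    chain rule above expects. *)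
Let pairE y : (h false y, h true y) =
  \sum_(p : bool * 'I_d) h p.1 y p.2 0 *: arg_dir R p.1 p.2.
Proof.
rewrite -(pair_bigA _ (fun s k => h s y k 0 *: arg_dir R s k)) /= big_bool /=.
have hE s : h s y = \sum_k h s y k 0 *: basis_vec R k.
  rewrite {1}(matrix_sum_delta (h s y)); apply: eq_bigr => k _.
  by rewrite big_ord1.
have sumE (p : 'I_d -> ('cV[R]_d * 'cV[R]_d)%type) :
    \sum_k p k = (\sum_k (p k).1, \sum_k (p k).2).
  by elim/big_rec3 : _ => // k x1 x2 x3 _ ->; case: (p k).
rewrite !sumE /=; under [X in (X, _) + _]eq_bigr do rewrite scaler0.
under [X in _ + (_, X)]eq_bigr do rewrite scaler0.
rewrite !big1_eq -!hE; congr (_, _); first by rewrite /= add0r.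
by rewrite /= addr0.
Qed.

Let msg y := psi (h false y) (h true y).
Let arg y := (h false y, h true y).

Let msgE l : (fun y => msg y l 0) = fun y =>
  psi2 psi (\sum_(p : bool * 'I_d) h p.1 y p.2 0 *: arg_dir R p.1 p.2) l 0.
Proof. by apply/funext => y; rewrite -pairE. Qed.

Let psi_l2 l : twice_differentiable
  ((fun p => psi2 psi p l 0) : ('cV[R]_d * 'cV[R]_d)%type -> R).
Proof. exact: twice_differentiable_entry. Qed.

Let edir (p : bool * 'I_d) := arg_dir R p.1 p.2.

Let h_2' (p : bool * 'I_d) :
  twice_differentiable ((fun y => h p.1 y p.2 0) : U -> R).
Proof. exact: h_2. Qed.

Lemma twice_differentiable_msg l :
  twice_differentiable ((fun y => msg y l 0) : U -> R).
Proof.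
rewrite msgE.
exact: (twice_differentiable_comp_span edir h_2' (psi_l2 l)).
Qed.

Lemma dvec_msg b y :
  dvec msg b y = \sum_s psi_jac psi s (arg y) *m dvec (h s) b y.
Proof.
apply/colP => l; rewrite summxE mxE msgE.
have [dpsi_l _] := psi_l2 l.
rewrite (derive_comp_span edir h_2' y b dpsi_l).
rewrite -pairE -(pair_bigA _ (fun s k => 'D_b (fun y => h s y k 0) y *
  'D_(arg_dir R s k) (fun p => psi2 psi p l 0) (arg y))) /=.
apply: eq_bigr => s _; rewrite mxE; apply: eq_bigr => k _.
rewrite !mxE mulrC; congr (_ * _).
  by have [dpsi _] := psi_2; exact: (derive_coord _ _ _ (dpsi _)).
Qed.

Lemma d2vec_msg a b y :
  d2vec msg a b y = \sum_s psi_jac psi s (arg y) *m d2vec (h s) a b y +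
    \sum_s \sum_s' psi_hess_block psi s' s (arg y) *m
      (mxvec (\matrix_(i, j) (dvec (h s') a y i 0 * dvec (h s) b y j 0)))^T.
Proof.
apply/colP => l; rewrite [RHS]mxE !summxE mxE msgE.
rewrite (derive2_comp_span edir h_2' (psi_l2 l)) -pairE; congr (_ + _).
  rewrite -(pair_bigA _ (fun s k => 'D_a ('D_b (fun y => h s y k 0)) y *
    'D_(arg_dir R s k) (fun p => psi2 psi p l 0) (arg y))) /=.
  apply: eq_bigr => s _; rewrite mxE; apply: eq_bigr => k _.
  rewrite !mxE mulrC; congr (_ * _).
  by have [dpsi _] := psi_2; exact: (derive_coord _ _ _ (dpsi _)).
rewrite -(pair_bigA _ (fun s k => \sum_j 'D_b (fun y => h s y k 0) y *
    'D_a (fun y => h j.1 y j.2 0) y *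
  'D_(arg_dir R j.1 j.2) ('D_(arg_dir R s k) (fun p => psi2 psi p l 0)) (arg y))) /=.
apply: eq_bigr => s _; rewrite exchange_big /= summxE.
rewrite -(pair_bigA _ (fun s' i => \sum_k 'D_b (fun y => h s y k 0) y *
    'D_a (fun y => h s' y i 0) y *
  'D_(arg_dir R s' i) ('D_(arg_dir R s k) (fun p => psi2 psi p l 0)) (arg y))) /=.
apply: eq_bigr => s' _; rewrite mxE (reindex _ (curry_mxvec_bij d d)) /=.
rewrite pair_bigA /=; apply: eq_bigr => -[i j] _ /=.
rewrite !mxE !mxvecE !mxE (derive2_entry _ _ _ _ _ psi_2); ring.
Qed.

Lemma norm2_dvec_msg_le c1 c2 b y :
  opnorm (psi_jac psi false (arg y)) <= c1 ->
  opnorm (psi_jac psi true (arg y)) <= c2 ->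
  norm2 (dvec msg b y) <=
    c1 * norm2 (dvec (h false) b y) + c2 * norm2 (dvec (h true) b y).
Proof.
move=> J1 J2; rewrite dvec_msg big_bool /= addrC.
by apply: le_trans (norm2D _ _) _; apply: lerD; apply: norm2_mulmx_le.
Qed.

(** Each of the four Hessian blocks is bounded by the full [cH], and the four products of gradient
    norms add up to a product of two sums. *)
Lemma norm2_d2vec_msg_le c1 c2 cH a b y :
  opnorm (psi_jac psi false (arg y)) <= c1 ->
  opnorm (psi_jac psi true (arg y)) <= c2 ->
  opnorm (psi_hess psi (arg y)) <= cH ->
  norm2 (d2vec msg a b y) <=
    c1 * norm2 (d2vec (h false) a b y) + c2 * norm2 (d2vec (h true) a b y) +
    cH * ((norm2 (dvec (h false) a y) + norm2 (dvec (h true) a y)) *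
          (norm2 (dvec (h false) b y) + norm2 (dvec (h true) b y))).
Proof.
move=> J1 J2 /norm2_block_mx[Hff Hft Htf Htt].
have HB s s' : norm2 (psi_hess_block psi s' s (arg y) *m
    (mxvec (\matrix_(i, j) (dvec (h s') a y i 0 * dvec (h s) b y j 0)))^T) <=
    cH * (norm2 (dvec (h s') a y) * norm2 (dvec (h s) b y)).
  rewrite -(norm2_outer (dvec (h s') a y) (dvec (h s) b y)).
  case: s s' => [] []; [exact: Htt|exact: Hft|exact: Htf|exact: Hff].
rewrite d2vec_msg; apply: le_trans (norm2D _ _) _; apply: lerD.
  rewrite big_bool /= addrC.
  by apply: le_trans (norm2D _ _) _; apply: lerD; apply: norm2_mulmx_le.
apply: le_trans (norm2_sum _) _.
apply: (@le_trans _ _ (\sum_s \sum_s'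
    cH * (norm2 (dvec (h s') a y) * norm2 (dvec (h s) b y)))).
  apply: ler_sum => s _; apply: le_trans (norm2_sum _) _.
  by apply: ler_sum => s' _; apply: HB.
rewrite !big_bool /= le_eqVlt; apply/orP; left; apply/eqP.
move: (norm2 _) (norm2 _) (norm2 _) (norm2 _) => z1 z2 z3 z4; ring.
Qed.

End MessageJets.

Section VectorJets.
Variables (R : realType) (d : nat) (U : normedModType R).
Implicit Types f : U -> 'cV[R]_d.

Lemma dvecE f b y k : dvec f b y k 0 = 'D_b (fun z => f z k 0) y.
Proof. exact: mxE. Qed.

Lemma d2vecE f a b y k :
  d2vec f a b y k 0 = 'D_a ('D_b (fun z => f z k 0)) y.
Proof. exact: mxE. Qed.

Definition entrywise_twice_differentiable f :=
  forall k, twice_differentiable ((fun y => f y k 0) : U -> R).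

Section LinearCombination.
Variables (I : finType) (C : I -> 'M[R]_d) (F : I -> U -> 'cV[R]_d).
Hypothesis F2 : forall i, entrywise_twice_differentiable (F i).
Let g y := \sum_i C i *m F i y.

Let gE k : (fun y => g y k 0) =
  fun y => \sum_(p : I * 'I_d) C p.1 k p.2 * F p.1 y p.2 0.
Proof.
apply/funext => y; rewrite summxE.
rewrite -(pair_bigA _ (fun i l => C i k l * F i y l 0)) /=.
by apply: eq_bigr => i _; rewrite mxE.
Qed.

Let F2' (p : I * 'I_d) :
  twice_differentiable ((fun y => F p.1 y p.2 0) : U -> R).
Proof. exact: F2. Qed.

Lemma entrywise_twice_differentiable_lincomb : entrywise_twice_differentiable g.
Proof.
move=> k; rewrite gE.
exact: (twice_differentiable_lincomb (fun p => C p.1 k p.2) F2').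
Qed.

Lemma dvec_lincomb b y : dvec g b y = \sum_i C i *m dvec (F i) b y.
Proof.
apply/colP => k; rewrite mxE gE.
rewrite (derive_lincomb (fun p => C p.1 k p.2) b (fun p => (F2' p).1 y)).
rewrite -(pair_bigA _ (fun i l => C i k l * 'D_b (fun y => F i y l 0) y)) /=.
rewrite summxE; apply: eq_bigr => i _; rewrite mxE; apply: eq_bigr => l _.
by rewrite mxE.
Qed.

Lemma d2vec_lincomb a b y : d2vec g a b y = \sum_i C i *m d2vec (F i) a b y.
Proof.
apply/colP => k; rewrite mxE gE.
rewrite (derive2_lincomb (fun p => C p.1 k p.2) F2').
rewrite -(pair_bigA _ (fun i l => C i k l * 'D_a ('D_b (fun y => F i y l 0)) y)) /=.
rewrite summxE; apply: eq_bigr => i _; rewrite mxE; apply: eq_bigr => l _.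
by rewrite mxE.
Qed.

End LinearCombination.

Section Activation.
Variables (s : R -> R) (f : U -> 'cV[R]_d).
Hypotheses (s2 : twice_differentiable s) (f2 : entrywise_twice_differentiable f)
  (s_d1 : forall x, `|derive1 s x| <= 1)
  (s_d2 : forall x, `|derive1 (derive1 s) x| <= 1).
Let g y := map_mx s (f y).

Let gE k : (fun y => g y k 0) = fun y => s (f y k 0).
Proof. by apply/funext => y; rewrite mxE. Qed.

Lemma entrywise_twice_differentiable_map : entrywise_twice_differentiable g.
Proof. by move=> k; rewrite gE; apply: (twice_differentiable_chain s2 (f2 k)). Qed.

Lemma norm2_dvec_map b y : norm2 (dvec g b y) <= norm2 (dvec f b y).
Proof.
apply: norm2_mono => k; rewrite !dvecE gE (derive_chain s2 (f2 k)) normrM.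
by rewrite ler_piMr.
Qed.

(** The second-order chain rule gives a term with s' and a Hadamard product of the two gradients
    with s''; both scalar factors are at most 1 in absolute value. *)
Lemma norm2_d2vec_map a b y : norm2 (d2vec g a b y) <=
  norm2 (dvec f a y) * norm2 (dvec f b y) + norm2 (d2vec f a b y).
Proof.
rewrite (mulrC (norm2 _)) addrC.
have -> : d2vec g a b y =
    \col_k (d2vec f a b y k 0 * derive1 s (f y k 0)) +
    \col_k (dvec f b y k 0 * dvec f a y k 0 * derive1 (derive1 s) (f y k 0)).
  apply/colP => k; rewrite [LHS]mxE [RHS]mxE [X in _ = X + _]mxE.
  by rewrite [X in _ = _ + X]mxE !dvecE d2vecE gE (derive2_chain s2 (f2 k)).
apply: le_trans (norm2D _ _) _; apply: lerD.
  by apply: norm2_mono => k; rewrite mxE normrM ler_piMr.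
apply: le_trans (norm2_hadamard _ _); apply: norm2_mono => k.
by rewrite mxE [X in _ <= `|X|]mxE normrM ler_piMr.
Qed.

End Activation.

End VectorJets.

(** * Layerwise recursions and readouts *)

Section HiddenJets.
Variables (R : realType) (n d m : nat) (N : mpnn R d) (A : 'M[R]_n).
Variables (omega w c1 c2 cH : R).
Hypotheses (HN : mpnn_bounds m N omega w c1 c2 cH)
  (A_ge0 : forall i j, 0 <= A i j).

Definition hid t i (X : 'M[R]_(n, d)) := hidden N A t X i.

Let msg t i j X := msg_fun N t.+1 (hid t i X) (hid t j X).

(** The pre-activation is one linear combination indexed by [unit + 'I_n]: the left summand is the
    residual branch, the right one carries the messages from the nodes. *)
Let coef t i (s : unit + 'I_n) : 'M[R]_d :=
  if s is inr j then A i j *: msg_mx N t.+1 else res_mx N t.+1.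
Let part t i (s : unit + 'I_n) : 'M[R]_(n, d) -> 'cV[R]_d :=
  if s is inr j then msg t i j else hid t i.
Let pre t i X := \sum_s coef t i s *m part t i s X.

Let hidS t i : hid t.+1 i = fun X => map_mx (act N) (pre t i X).
Proof.
apply/funext => X; rewrite /hid /= /pre big_sumType /=; congr (map_mx _ (_ + _)).
  by rewrite (big_pred1 tt) // => -[].
rewrite mulmx_sumr; apply: eq_bigr => j _.
by rewrite -scalemxAr scalemxAl.
Qed.

Let hid0E i k :
  (fun X => hid 0 i X k 0) = (fun X => X i k) :> ('M[R]_(n, d) -> R).
Proof. by apply/funext => X; rewrite !mxE. Qed.

Let choose t i j (s : bool) := hid t (if s then j else i).

Lemma hid_twice_differentiable t i : (t <= m)%N ->
  entrywise_twice_differentiable (hid t i).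
Proof.
elim: t i => [|t IH] i tm.
  by move=> k; rewrite hid0E; apply: twice_differentiable_coord.
rewrite hidS; apply: entrywise_twice_differentiable_map.
  by have [] := act_C2 HN.
apply: entrywise_twice_differentiable_lincomb => -[[]|j].
  by apply: IH; apply: ltnW.
move=> k; apply: (@twice_differentiable_msg _ _ _ (msg_fun N t.+1) (choose t i j)).
  by have [] := msg_C2 HN (t := t.+1) tm.
by move=> s; apply: IH; apply: ltnW.
Qed.

Let part2 t i s : (t < m)%N -> entrywise_twice_differentiable (part t i s).
Proof.
move=> tm; case: s => [[]|j]; first by apply: hid_twice_differentiable; apply: ltnW.
move=> k; apply: (@twice_differentiable_msg _ _ _ (msg_fun N t.+1) (choose t i j)).
  by have [] := msg_C2 HN (t := t.+1) tm.
by move=> s; apply: hid_twice_differentiable; apply: ltnW.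
Qed.

Let p t a X i := norm2 (dvec (hid t i) a X).
Let z t a b X i := norm2 (d2vec (hid t i) a b X).

Let norm2_dvec_pre t i a X : (t < m)%N ->
  norm2 (dvec (pre t i) a X) <=
  omega * p t a X i + w * \sum_j A i j * (c1 * p t a X i + c2 * p t a X j).
Proof.
move=> tm; rewrite dvec_lincomb => [|s]; last exact: part2.
rewrite big_sumType /= (big_pred1 tt) => [|[]] //=.
apply: le_trans (norm2D _ _) _; apply: lerD.
  by apply: norm2_mulmx_le; apply: (res_le HN (t := t.+1)).
apply: le_trans (norm2_sum _) _; rewrite mulr_sumr; apply: ler_sum => j _.
rewrite -scalemxAl norm2Z ger0_norm // mulrCA ler_wpM2l //.
apply: le_trans (norm2_mulmx_le _ (msg_le HN (t := t.+1) tm)) _.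
rewrite ler_wpM2l ?(ltW (w_gt0 HN)) //.
apply: (@norm2_dvec_msg_le _ _ _ (msg_fun N t.+1) (choose t i j)).
- by have [] := msg_C2 HN (t := t.+1) tm.
- by move=> s; apply: hid_twice_differentiable; apply: ltnW.
- exact: (jac1_le HN (t := t.+1) tm).
- exact: (jac2_le HN (t := t.+1) tm).
Qed.

Lemma norm2_dvec_hidS t i a X : (t < m)%N ->
  norm2 (dvec (hid t.+1 i) a X) <=
  omega * norm2 (dvec (hid t i) a X) + w * \sum_j A i j *
    (c1 * norm2 (dvec (hid t i) a X) + c2 * norm2 (dvec (hid t j) a X)).
Proof.
move=> tm; rewrite hidS; apply: le_trans (norm2_dvec_pre i a X tm).
apply: norm2_dvec_map; first by have [] := act_C2 HN.
- by apply: entrywise_twice_differentiable_lincomb => s; apply: part2.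
- exact: (act_d1 HN).
Qed.

(** [P] and [Q] are left free so that entries of T^(t+1) can later bound the two pre-activation
    gradients that multiply the second derivative of the activation. *)
Lemma norm2_d2vec_hidS t i a b X (P Q : R) : (t < m)%N ->
  omega * p t a X i + w * (\sum_j A i j * (c1 * p t a X i + c2 * p t a X j)) <= P ->
  omega * p t b X i + w * (\sum_j A i j * (c1 * p t b X i + c2 * p t b X j)) <= Q ->
  norm2 (d2vec (hid t.+1 i) a b X) <= P * Q +
  (omega * z t a b X i + w * \sum_j A i j * (c1 * z t a b X i + c2 * z t a b X j +
     cH * ((p t a X i + p t a X j) * (p t b X i + p t b X j)))).
Proof.
move=> tm pP qQ; rewrite hidS.
apply: le_trans (norm2_d2vec_map _ _ (act_d1 HN) (act_d2 HN) _ _ _) _.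
- by have [] := act_C2 HN.
- by apply: entrywise_twice_differentiable_lincomb => s; apply: part2.
apply: lerD.
  apply: ler_pM; rewrite ?norm2_ge0 //.
    exact: le_trans (norm2_dvec_pre i a X tm) pP.
  exact: le_trans (norm2_dvec_pre i b X tm) qQ.
rewrite d2vec_lincomb => [|s]; last exact: part2.
rewrite big_sumType /= (big_pred1 tt) => [|[]] //=.
apply: le_trans (norm2D _ _) _; apply: lerD.
  by apply: norm2_mulmx_le; apply: (res_le HN (t := t.+1)).
apply: le_trans (norm2_sum _) _; rewrite mulr_sumr; apply: ler_sum => j _.
rewrite -scalemxAl norm2Z ger0_norm // mulrCA ler_wpM2l //.
apply: le_trans (norm2_mulmx_le _ (msg_le HN (t := t.+1) tm)) _.
rewrite ler_wpM2l ?(ltW (w_gt0 HN)) //.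
apply: (@norm2_d2vec_msg_le _ _ _ (msg_fun N t.+1) (choose t i j)).
- by have [] := msg_C2 HN (t := t.+1) tm.
- by move=> s; apply: hid_twice_differentiable; apply: ltnW.
- exact: (jac1_le HN (t := t.+1) tm).
- exact: (jac2_le HN (t := t.+1) tm).
- exact: (hess_le HN (t := t.+1) tm).
Qed.

Lemma norm2_dvec_hid0 (v i : 'I_n) (al : 'I_d) X :
  norm2 (dvec (hid 0 i) (delta_mx v al) X) = (i == v)%:R.
Proof.
have -> : dvec (hid 0 i) (delta_mx v al) X = (i == v)%:R *: delta_mx al 0.
  apply/colP => k; rewrite dvecE hid0E derive_entry_id !mxE.
  by rewrite eqxx andbT -natrM mulnb.
rewrite norm2Z normr_nat /norm2 (bigD1 al) //= big1 => [|k ka].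
  by rewrite addr0 mxE !eqxx expr1n sqrtr1 mulr1.
by rewrite mxE (negbTE ka) expr0n.
Qed.

Lemma norm2_d2vec_hid0 i a b X : norm2 (d2vec (hid 0 i) a b X) = 0.
Proof.
rewrite (_ : d2vec _ _ _ _ = 0) ?norm20 //.
by apply/colP => k; rewrite d2vecE hid0E derive2_entry_id mxE.
Qed.

Section Readout.
Variables (J : finType) (c : J -> 'I_d -> 'I_n -> R).
Hypothesis c_le1 : forall j k i, `|c j k i| <= 1.

(** A branch [j] of the readout: linear in the hidden features, with coefficients at most 1 in
    absolute value. The mean and the sum have a single branch, the maximum has one for each way of
    picking a node per coordinate. *)
Let g j (X : 'M[R]_(n, d)) :=
  \sum_(s : 'I_d * 'I_n) (out_vec N s.1 0 * c j s.1 s.2) * hid m s.2 X s.1 0.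

Let hid2 (s : 'I_d * 'I_n) :
  twice_differentiable ((fun X => hid m s.2 X s.1 0) : 'M[R]_(n, d) -> R).
Proof. exact: hid_twice_differentiable. Qed.

(** Cauchy-Schwarz at each node pairs the unit vector [out_vec] with the vector of second
    derivatives, which the coefficients [c] can only shrink. *)
Lemma normr_derive2_readout j a b X :
  `|'D_a ('D_b (g j)) X| <= \sum_i norm2 (d2vec (hid m i) a b X).
Proof.
rewrite (derive2_lincomb (fun s => out_vec N s.1 0 * c j s.1 s.2) hid2).
rewrite -(pair_bigA _ (fun k i => (out_vec N k 0 * c j k i) *
  'D_a ('D_b (fun X => hid m i X k 0)) X)) /= exchange_big /=.
apply: le_trans (ler_norm_sum _ _ _) _; apply: ler_sum => i _.
have CS (x : 'cV[R]_d) : (forall k, `|x k 0| <= `|d2vec (hid m i) a b X k 0|) ->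
    \sum_k out_vec N k 0 * x k 0 <= norm2 (d2vec (hid m i) a b X).
  move=> xle; apply: le_trans (cauchy_schwarz _ _) _.
  by rewrite (out_unit HN) mul1r norm2_mono.
rewrite ler_norml lerNl -sumrN; apply/andP; split.
  have := CS (\col_k - (c j k i * d2vec (hid m i) a b X k 0)).
  rewrite (eq_bigr (fun k => - (out_vec N k 0 * c j k i *
    'D_a ('D_b (fun X => hid m i X k 0)) X))) => [|k _]; last by rewrite !mxE; ring.
  by apply=> k; rewrite !mxE normrN normrM ler_piMl.
have := CS (\col_k (c j k i * d2vec (hid m i) a b X k 0)).
rewrite (eq_bigr (fun k => out_vec N k 0 * c j k i *
  'D_a ('D_b (fun X => hid m i X k 0)) X)) => [|k _]; last by rewrite !mxE mulrA.
by apply=> k; rewrite !mxE normrM ler_piMl.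
Qed.

Lemma normr_derive2_selected (y : 'M[R]_(n, d) -> R) a b X :
  twice_differentiable y ->
  (forall Y, exists j, y Y = \sum_k out_vec N k 0 * \sum_i c j k i * hid m i Y k 0) ->
  `|'D_a ('D_b y) X| <= \sum_i norm2 (d2vec (hid m i) a b X).
Proof.
move=> y2 sel; have [|Y|j ->] := @derive2_selection _ _ J y g X a b y2.
- by move=> j; apply: (twice_differentiable_lincomb _ hid2).
- have [j ->] := sel Y; exists j.
  rewrite /g -(pair_bigA _ (fun k i => (out_vec N k 0 * c j k i) * hid m i Y k 0)) /=.
  apply: eq_bigr => k _; rewrite mulr_sumr; apply: eq_bigr => i _.
  by rewrite mulrA.
exact: normr_derive2_readout.
Qed.

End Readout.

Lemma normr_derive2_mpnn (i0 : 'I_n) (y : 'M[R]_(n, d) -> R) a b X :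
  twice_differentiable y -> mpnn_output N A m = y ->
  `|'D_a ('D_b y) X| <= \sum_i norm2 (d2vec (hid m i) a b X).
Proof.
move=> y2 yE; case rE : (read N).
(* Branches of the maximum are functions [j] from coordinates to nodes; at [Y] the branch made of
   the maximisers [top] has the value of the readout. The node [i0] makes the maxima range over a
   nonempty set. *)
- apply: (@normr_derive2_selected _
    (fun (j : {ffun 'I_d -> 'I_n}) k i => (j k == i)%:R) _ y) => //.
    by move=> j k i; rewrite normr_nat lern1 leq_b1.
  move=> Y; pose top k := [arg max_(i > i0) hid m i Y k 0]%O.
  exists [ffun k => top k]; rewrite -yE; apply: eq_bigr => k _; congr (_ * _).
  rewrite mxE rE (bigD1 (top k)) //= ffunE eqxx mul1r big1 => [|i ik]; last first.
    by rewrite eq_sym (negbTE ik) mul0r.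
  rewrite addr0; have topP i : hid m i Y k 0 <= hid m (top k) Y k 0.
    by rewrite /top; case: arg_maxP => // j _; apply.
  apply/eqP; rewrite eq_le; apply/andP; split.
    by apply: ge_sup; [exists (hid m i0 Y k 0), i0|move=> _ [i _ <-]; exact: topP].
  apply: ub_le_sup; last by exists (top k).
  by exists (hid m (top k) Y k 0) => _ [i _ <-]; exact: topP.
- apply: (@normr_derive2_selected _ (fun (_ : unit) _ _ => n%:R^-1) _ y) => //.
    move=> _ _ _; rewrite ger0_norm // invf_le1 ?ler1n ?ltr0n //.
      exact: leq_ltn_trans (ltn_ord i0).
    exact: leq_ltn_trans (ltn_ord i0).
  move=> Y; exists tt; rewrite -yE; apply: eq_bigr => k _; congr (_ * _).
  by rewrite mxE rE mulrC mulr_sumr.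
- apply: (@normr_derive2_selected _ (fun (_ : unit) _ _ => 1) _ y) => //.
    by move=> _ _ _; rewrite normr1.
  move=> Y; exists tt; rewrite -yE; apply: eq_bigr => k _; congr (_ * _).
  by rewrite mxE rE; apply: eq_bigr => i _; rewrite mul1r.
Qed.

End HiddenJets.

(** * Spectrum of the normalized Laplacian *)

Section SymmetricSpectralTheorem.
Variable R : realType.

(* The Householder reflection exchanging [x] and the first basis vector. *)
Lemma orthonormal_extension n (x : 'cV[R]_n.+1) :
  x^T *m x = 1%:M ->
  exists2 Q : 'M[R]_n.+1, Q^T *m Q = 1%:M & Q *m delta_mx 0 0 = x.
Proof.
move=> x1; pose e0 : 'cV[R]_n.+1 := delta_mx 0 0.
have e1 : e0^T *m e0 = 1%:M.
  by rewrite trmx_delta mul_delta_mx; apply/matrixP => i j; rewrite !ord1 !mxE.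
have [->|xe0] := eqVneq x e0.
  by exists 1%:M; rewrite ?trmx1 mul1mx.
pose a := x 0 0.
have xe : x^T *m e0 = a%:M.
  by rewrite -colE; apply/matrixP => i j; rewrite !ord1 !mxE eqxx mulr1n.
have ex : e0^T *m x = a%:M.
  by rewrite -[x in LHS]trmxK -trmx_mul xe tr_scalar_mx.
(* Both vectors have norm 1, so |x - e0|^2 = 2 - 2 a = [s] and the reflection is I - (2 / s) w
   w^T. *)
pose w := x - e0; pose s := 2 - 2 * a.
have wT : w^T = x^T - e0^T by apply/matrixP => i j; rewrite !mxE.
have ww : w^T *m w = s%:M.
  rewrite wT mulmxBl !mulmxBr x1 e1 xe ex -!raddfB /=.
  by congr (_ %:M); rewrite /s; ring.
have we : w^T *m e0 = (a - 1)%:M.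
  by rewrite wT mulmxBl xe e1 -raddfB.
have s0 : s != 0.
  apply: contra xe0 => /eqP s0; rewrite -subr_eq0 -/w; apply/eqP.
  have : norm2 w ^+ 2 = 0.
    have /matrixP/(_ 0 0) := ww; rewrite !mxE s0 mul0rn => E.
    rewrite sqr_norm2 -[RHS]E; apply: eq_bigr => i _.
    by rewrite [w^T _ _]mxE expr2.
  by move=> /eqP; rewrite sqrf_eq0 => /eqP; apply: norm2_eq0.
pose P := w *m w^T; pose c := 2 / s.
have PT : P^T = P by rewrite trmx_mul trmxK.
have PP : P *m P = s *: P.
  by rewrite /P mulmxA -(mulmxA w) ww mul_mx_scalar -scalemxAl.
exists (1%:M - c *: P).
  rewrite (_ : (_ - _)^T = 1%:M - c *: P); last first.
    by rewrite -{2}PT -{2}(trmx1 _ n.+1); apply/matrixP => i j; rewrite !mxE.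
  rewrite mulmxBl !mulmxBr !mul1mx mulmx1.
  have cs : c * c * s = c + c by rewrite /c; field.
  rewrite -scalemxAl -scalemxAr PP !scalerA cs; clearbody P.
  by apply/matrixP => i j; rewrite !mxE; ring.
rewrite mulmxBl mul1mx -scalemxAl /P -mulmxA we mul_mx_scalar scalerA.
rewrite (_ : c * (a - 1) = -1); last by rewrite /c /s; field.
by rewrite scaleN1r opprK /w addrC subrK.
Qed.

Lemma char_poly_conj n (Q M : 'M[R]_n) :
  Q^T *m Q = 1%:M -> char_poly (Q^T *m M *m Q) = char_poly M.
Proof.
move=> QQ; rewrite /char_poly /char_poly_mx.
have QQp : map_mx polyC Q^T *m map_mx polyC Q = 1%:M.
  by rewrite -map_mxM QQ map_mx1.
rewrite !map_mxM /=.
have -> : 'X%:M - map_mx polyC Q^T *m map_mx polyC M *m map_mx polyC Q =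
    map_mx polyC Q^T *m ('X%:M - map_mx polyC M) *m map_mx polyC Q.
  rewrite mulmxBr mulmxBl mul_mx_scalar -scalemxAl QQp.
  by rewrite scalemx1.
by rewrite !det_mulmx mulrAC -det_mulmx QQp det1 mul1r.
Qed.

Lemma char_poly_block n (a : R) (M : 'M[R]_n) :
  char_poly (block_mx a%:M 0 0 M : 'M[R]_(1 + n)) = ('X - a%:P) * char_poly M.
Proof.
rewrite /char_poly char_block_diag_mx det_ublock; congr (_ * _).
rewrite [char_poly_mx _]mx11_scalar det_scalar1 !mxE /=.
by rewrite !mulr1n.
Qed.

Lemma symmetric_deflation n (N : 'M[R]_(1 + n)) a :
  N^T = N -> (forall i j, N i (lshift n j) = a * (i == lshift n j)%:R) ->
  N = block_mx a%:M 0 0 (drsubmx N).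
Proof.
move=> NT N0; rewrite -[LHS]submxK; congr block_mx; apply/matrixP => i j.
- by rewrite !mxE N0 !ord1 eqxx mulr1.
- by rewrite !mxE -NT mxE N0 eq_rlshift mulr0.
- by rewrite !mxE N0 eq_rlshift mulr0.
Qed.

(** Induction along [lam]: the characteristic polynomial is given in split form, so its first root
    has an eigenvector; reflecting this vector onto the first basis vector makes the matrix block
    diagonal, and cancelling one linear factor leaves the same hypothesis for the smaller block. The
    order of [lam] is kept, so the l-th column belongs to the l-th eigenvalue. *)
Lemma symmetric_spectral n (M : 'M[R]_n) (lam : seq R) :
  M^T = M -> char_poly M = \prod_(a <- lam) ('X - a%:P) ->
  exists2 Q : 'M[R]_n, Q^T *m Q = 1%:M &
    M = Q *m diag_mx (\row_i lam`_i) *m Q^T.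
Proof.
elim: n M lam => [|n IH] M lam MT ME.
  by exists 1%:M; [rewrite trmx1 mul1mx|apply/matrixP => -[]].
case: lam ME => [|a lam] ME.
  have := size_char_poly M.
  by rewrite ME big_nil size_poly1.
have /eigenvalueP[u uM u0] : eigenvalue M a.
  by rewrite eigenvalue_root_char ME big_cons rootM root_XsubC eqxx.
have nu0 : norm2 u^T != 0.
  apply: contra u0 => /eqP/norm2_eq0 u0.
  by rewrite -[u]trmxK u0 trmx0.
pose x := (norm2 u^T)^-1 *: u^T.
have x1 : x^T *m x = 1%:M.
  have n1 : norm2 x ^+ 2 = 1.
    by rewrite norm2Z ger0_norm ?invr_ge0 ?norm2_ge0 // mulVf // expr1n.
  apply/matrixP => i j; rewrite !ord1 !mxE eqxx -n1 sqr_norm2.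
  by apply: eq_bigr => k _; rewrite !mxE expr2.
have Mx : M *m x = a *: x.
  by rewrite -scalemxAr -{1}MT -trmx_mul uM linearZ /= !scalerA mulrC.
have [Q QQ Qx] := orthonormal_extension x1.
have QQ' : Q *m Q^T = 1%:M by apply: mulmx1C.
pose N : 'M[R]_(1 + n) := Q^T *m M *m Q.
have NT : N^T = N by rewrite /N !trmx_mul trmxK MT mulmxA.
have Ne : N *m delta_mx 0 0 = a *: (delta_mx 0 0 : 'cV[R]_(1 + n)).
  rewrite /N -!mulmxA Qx Mx -scalemxAr -Qx mulmxA QQ mul1mx //.
have N0 i (j : 'I_1) : N i (lshift n j) = a * (i == lshift n j)%:R.
  have -> : lshift n j = 0 by apply/val_inj; rewrite /= ord1.
  have /matrixP/(_ i 0) := Ne; rewrite -colE !mxE => ->.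
  by rewrite andbT.
have NE := symmetric_deflation NT N0.
have [||Q' QQ1 N'E] := IH (drsubmx N) lam.
- by rewrite -[in RHS]NT trmx_drsub.
- have E : ('X - a%:P) * char_poly (drsubmx N) =
      ('X - a%:P) * \prod_(b <- lam) ('X - b%:P).
    rewrite -char_poly_block -NE; move: ME; rewrite big_cons => <-.
    exact: char_poly_conj.
  by apply: (mulfI _ E); rewrite polyXsubC_eq0.
pose B : 'M[R]_(1 + n) := block_mx 1%:M 0 0 Q'.
have BB : B^T *m B = 1%:M.
  rewrite /B tr_block_mx mulmx_block !trmx0 !mulmx0 !mul0mx !addr0 add0r.
  by rewrite trmx1 mul1mx QQ1 -scalar_mx_block.
exists (Q *m B).
  by rewrite trmx_mul mulmxA -(mulmxA _ Q^T) QQ mulmx1.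
have -> : diag_mx (\row_i (a :: lam)`_i) =
    block_mx a%:M 0 0 (diag_mx (\row_i lam`_i)) :> 'M[R]_(1 + n).
  apply/matrixP => i j; rewrite !mxE.
  case: splitP => k kE; rewrite !mxE; case: splitP => l lE; rewrite !mxE.
  - by rewrite !ord1 in kE lE *; rewrite kE /= -val_eqE /= kE lE eqxx.
  - by rewrite -val_eqE /= kE lE ord1.
  - by rewrite -val_eqE /= kE lE ord1.
  - by rewrite -!val_eqE /= kE lE /= !add1n eqSS.
have BN : B *m block_mx a%:M 0 0 (diag_mx (\row_i lam`_i)) *m B^T = N.
  rewrite NE N'E /B tr_block_mx !mulmx_block.
  by rewrite !(trmx1, trmx0, mulmx1, mul1mx, mulmx0, mul0mx, addr0, add0r).
rewrite trmx_mul mulmxA -!(mulmxA Q) BN /N !mulmxA QQ' mul1mx -mulmxA QQ'.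
by rewrite mulmx1.
Qed.

End SymmetricSpectralTheorem.

Section GraphSpectrum.
Variables (R : realType) (n : nat) (e : rel 'I_n) (lam : seq R).

Definition sdeg (i : 'I_n) : R := Num.sqrt (deg e i)%:R.

(** [psi l] is a unit eigenvector for the l-th entry of [lam]. The ground state is recorded through
    products of two of its entries, which do not depend on the choice of its sign. *)
Record laplacian_eigenbasis (psi : 'I_n -> 'I_n -> R) : Prop := {
  eigen_orth : forall l k, \sum_v psi l v * psi k v = (l == k)%:R;
  eigen_complete : forall v u, \sum_l psi l v * psi l u = (v == u)%:R;
  eigen_A_sym : forall v u,
    A_sym R e v u = \sum_(l < n) (1 - lam`_l) * (psi l v * psi l u);
  eigen_le2 : forall l : 'I_n, 0 <= lam`_l <= 2;
  eigen0 : lam`_0 = 0;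
  eigen1_gt0 : 0 < lam`_1;
  eigen_ge1 : forall l : 'I_n, (0 < l)%N -> lam`_1 <= lam`_l;
  eigen_ground : forall (l v u : 'I_n), l = 0 :> nat ->
    psi l v * psi l u = sdeg v * sdeg u / (2 * (num_edges e)%:R)
}.

Lemma A_sym_eigenvector (psi : 'I_n -> 'I_n -> R) :
  (forall l k, \sum_v psi l v * psi k v = (l == k)%:R) ->
  (forall v u, A_sym R e v u =
     \sum_(l < n) (1 - lam`_l) * (psi l v * psi l u)) ->
  forall (l i : 'I_n), \sum_j A_sym R e i j * psi l j = (1 - lam`_l) * psi l i.
Proof.
move=> orth AE l i.
under eq_bigr => j _ do rewrite AE mulr_suml.
rewrite exchange_big /= (bigD1 l) //= [X in _ + X]big1 ?addr0 => [|k kl].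
  rewrite (eq_bigr (fun j => (1 - lam`_l) * psi l i * (psi l j * psi l j))).
    by rewrite -mulr_sumr orth eqxx mulr1.
  by move=> j _; ring.
rewrite (eq_bigr (fun j => (1 - lam`_k) * psi k i * (psi k j * psi l j))).
  by rewrite -mulr_sumr orth (negbTE kl) mulr0.
by move=> j _; ring.
Qed.

Hypotheses (simple_e : simple_graph e) (conn_e : connected_graph e)
  (n_gt1 : (1 < n)%N).

Lemma deg_gt0 i : (0 < deg e i)%N.
Proof.
have [j ij] : exists j : 'I_n, j != i.
  have i0 : (0 < n)%N by apply: ltnW.
  case: (eqVneq i (Ordinal i0)) => [->|ni]; last by exists (Ordinal i0); rewrite eq_sym.
  by exists (Ordinal n_gt1).
have /connectP[[|k p] /= +] := conn_e i j.
  by move=> _ ji; rewrite ji eqxx in ij.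
by move=> /andP[eik _] _; rewrite card_gt0; apply/set0Pn; exists k; rewrite inE.
Qed.

Lemma natr_deg i : (deg e i)%:R = \sum_j (e i j)%:R :> R.
Proof.
rewrite /deg -sum1_card natr_sum big_mkcond /=; apply: eq_bigr => j _.
by rewrite inE; case: (e i j).
Qed.

Lemma sdeg_gt0 i : 0 < sdeg i.
Proof. by rewrite sqrtr_gt0 ltr0n deg_gt0. Qed.

Lemma sqr_sdeg i : sdeg i ^+ 2 = (deg e i)%:R.
Proof. by rewrite sqr_sqrtr ?ler0n. Qed.

Lemma A_symE i j : A_sym R e i j = (e i j)%:R / (sdeg i * sdeg j).
Proof.
rewrite /A_sym /deg_rsqrt mul_diag_mx mul_mx_diag !mxE -/(sdeg i) -/(sdeg j).
by rewrite invfM mulrCA mulrA.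
Qed.

Lemma A_sym_ge0 i j : 0 <= A_sym R e i j.
Proof. by rewrite A_symE divr_ge0 ?ler0n // mulr_ge0 // sqrtr_ge0. Qed.

Lemma A_symC i j : A_sym R e i j = A_sym R e j i.
Proof. by rewrite !A_symE (simple_e.1 i j) mulrC [sdeg i * _]mulrC mulrC. Qed.

Lemma A_sym_sdeg i : \sum_j A_sym R e i j * sdeg j = sdeg i.
Proof.
rewrite (eq_bigr (fun j => (e i j)%:R / sdeg i)) => [|j _].
  rewrite -mulr_suml -natr_deg -sqr_sdeg expr2 mulfK //.
  by rewrite gt_eqF // sdeg_gt0.
rewrite A_symE; field.
by rewrite !gt_eqF ?sdeg_gt0.
Qed.

(** Handshake: the neighbours of each node are split into larger and smaller ones, and by symmetry
    each half counts the increasing edges. *)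
Lemma sum_deg : \sum_i (deg e i)%:R = 2 * (num_edges e)%:R :> R.
Proof.
have [sym irr] := simple_e.
rewrite (eq_bigr (fun i : 'I_n => \sum_(j < n) ((i < j)%N && e i j)%:R +
    \sum_(j < n) ((j < i)%N && e i j)%:R)) => [|i _]; last first.
  rewrite natr_deg -big_split /=; apply: eq_bigr => j _.
  case: (ltngtP i j) => [||/val_inj ->] /=; rewrite ?addr0 ?add0r //.
  by rewrite irr.
rewrite big_split /= [X in _ + X]exchange_big /=.
rewrite [X in _ + X](eq_bigr (fun i : 'I_n => \sum_(j < n) ((i < j)%N && e i j)%:R)); last first.
  by move=> i _; apply: eq_bigr => j _; rewrite sym.
rewrite -mulr2n [RHS]mulr_natl; congr (_ *+ _).
rewrite /num_edges -sum1_card natr_sum [RHS]big_mkcond /= pair_bigA /=.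
by apply: eq_bigr => p _; rewrite inE; case: (_ && _).
Qed.

Lemma num_edges_gt0 : 0 < (num_edges e)%:R :> R.
Proof.
have i0 : (0 < n)%N by apply: ltnW.
have : 0 < 2 * (num_edges e)%:R :> R.
  rewrite -sum_deg (bigD1 (Ordinal i0)) //= ltr_pwDl ?ltr0n ?deg_gt0 //.
  by apply: sumr_ge0 => i _; apply: ler0n.
by rewrite pmulr_rgt0.
Qed.

(** With [eps] = 1 this is twice the quadratic form of I - A_sym, with [eps] = -1 twice that of I +
    A_sym. Positivity of both confines the Laplacian eigenvalues to [0, 2]. *)
Lemma dirichlet_form (eps : R) (f : 'I_n -> R) : eps ^+ 2 = 1 ->
  \sum_i \sum_j (e i j)%:R * (f i / sdeg i - eps * (f j / sdeg j)) ^+ 2 =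
  2 * (\sum_i f i ^+ 2) - 2 * eps * \sum_i \sum_j A_sym R e i j * (f i * f j).
Proof.
move=> eps2; have [sym irr] := simple_e.
have sq i : \sum_j (e i j)%:R * (f i / sdeg i) ^+ 2 = f i ^+ 2.
  rewrite -mulr_suml -natr_deg -sqr_sdeg; field.
  by rewrite gt_eqF ?sdeg_gt0.
transitivity (\sum_i \sum_j ((e i j)%:R * (f i / sdeg i) ^+ 2 +
    (e i j)%:R * (f j / sdeg j) ^+ 2 - 2 * eps * (A_sym R e i j * (f i * f j)))).
  apply: eq_bigr => i _; apply: eq_bigr => j _; rewrite A_symE.
  have -> : (e i j)%:R / (sdeg i * sdeg j) * (f i * f j) =
     (e i j)%:R * (f i / sdeg i) * (f j / sdeg j) by rewrite invfM; ring.
  move: (f i / _) (f j / _) => a b.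
  rewrite sqrrB exprMn eps2; ring.
under eq_bigr do rewrite big_split big_split /= sumrN -mulr_sumr.
rewrite big_split big_split /= sumrN -mulr_sumr; congr (_ - _).
rewrite [X in _ + X]exchange_big /= mulr_natl mulr2n; congr (_ + _).
  by apply: eq_bigr => i _; rewrite sq.
apply: eq_bigr => i _; rewrite -[RHS]sq; apply: eq_bigr => j _.
by rewrite sym.
Qed.

Lemma laplacian_eigenbasis_exists :
  is_spectrum (norm_lap R e) lam -> exists psi, laplacian_eigenbasis psi.
Proof.
move=> [lam_sorted lamE].
have LT : (norm_lap R e)^T = norm_lap R e.
  have AT : (A_sym R e)^T = A_sym R e.
    by apply/matrixP => i j; rewrite mxE A_symC.
  by rewrite /norm_lap raddfB /= trmx1 AT.
have [Q QQ LE] := symmetric_spectral LT lamE.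
have QQ' : Q *m Q^T = 1%:M by apply: mulmx1C.
have lam_size : size lam = n.
  have := size_char_poly (norm_lap R e).
  by rewrite lamE size_prod_XsubC => -[].
pose psi l v := Q v l; exists psi.
have orth l k : \sum_v psi l v * psi k v = (l == k)%:R.
  have /matrixP/(_ l k) := QQ; rewrite !mxE => <-.
  by apply: eq_bigr => v _; rewrite mxE.
have complete v u : \sum_l psi l v * psi l u = (v == u)%:R.
  have /matrixP/(_ v u) := QQ'; rewrite !mxE => <-.
  by apply: eq_bigr => l _; rewrite mxE.
have AE v u : A_sym R e v u = \sum_(l < n) (1 - lam`_l) * (psi l v * psi l u).
  have /matrixP/(_ v u) := LE; rewrite [LHS]mxE [X in X + _]mxE [X in _ + X]mxE.
  move=> /eqP; rewrite subr_eq addrC -subr_eq => /eqP <-.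
  rewrite (eq_bigr (fun l : 'I_n => psi l v * psi l u - lam`_l * (psi l v * psi l u))).
    rewrite sumrB complete; congr (_ - _); rewrite mul_mx_diag mxE.
    by apply: eq_bigr => l _; rewrite !mxE /psi; ring.
  by move=> l _; ring.
have Apsi := A_sym_eigenvector orth AE.
have quad (l : 'I_n) : \sum_i \sum_j A_sym R e i j * (psi l i * psi l j) = 1 - lam`_l.
  rewrite (eq_bigr (fun i => (1 - lam`_l) * (psi l i * psi l i))) => [|i _].
    by rewrite -mulr_sumr orth eqxx mulr1.
  rewrite mulrCA -Apsi mulr_sumr; apply: eq_bigr => j _; ring.
have sqsum l : \sum_i psi l i ^+ 2 = 1.
  by have := orth l l; rewrite eqxx; apply: etrans; apply: eq_bigr.
have form (l : 'I_n) eps : eps ^+ 2 = 1 ->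
    \sum_i \sum_j (e i j)%:R * (psi l i / sdeg i - eps * (psi l j / sdeg j)) ^+ 2 =
    2 - 2 * eps * (1 - lam`_l).
  by move=> eps1; rewrite dirichlet_form // sqsum quad mulr1.
have form_ge0 l eps : 0 <=
    \sum_i \sum_j (e i j)%:R * (psi l i / sdeg i - eps * (psi l j / sdeg j)) ^+ 2.
  by apply: sumr_ge0 => i _; apply: sumr_ge0 => j _; rewrite mulr_ge0 ?sqr_ge0.
have lam_bd (l : 'I_n) : 0 <= lam`_l <= 2.
  have := form_ge0 l 1; have := form_ge0 l (-1).
  rewrite !form ?expr1n ?sqrrN ?expr1n //; lra.
(* A vanishing Dirichlet form makes [psi l] divided by [sdeg] equal at the two ends of every edge,
   hence constant by connectivity. *)
have kernel (l : 'I_n) : lam`_l = 0 -> exists k, forall i, psi l i = k * sdeg i.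
  move=> l0; pose i0 := Ordinal (ltnW n_gt1).
  have edge i j : e i j -> psi l i / sdeg i = psi l j / sdeg j.
    move=> eij; have := form l 1 (expr1n _ _).
    rewrite l0 subr0 !mulr1 subrr => /eqP.
    rewrite psumr_eq0 => [|i' _]; last first.
      by apply: sumr_ge0 => j' _; rewrite mulr_ge0 ?sqr_ge0.
    move=> /allP/(_ i (mem_index_enum _)) /=.
    rewrite psumr_eq0 => [|j' _]; last by rewrite mulr_ge0 ?sqr_ge0.
    move=> /allP/(_ j (mem_index_enum _)) /=.
    by rewrite eij mul1r mul1r sqrf_eq0 subr_eq0 => /eqP.
  exists (psi l i0 / sdeg i0) => i.
  have -> : psi l i0 / sdeg i0 = psi l i / sdeg i.
    have /connectP[p + ->] := conn_e i0 i.
    elim: p i0 => //= k p IH j /andP[ejk kp].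
    by rewrite (edge _ _ ejk) IH.
  by rewrite divfK // gt_eqF ?sdeg_gt0.
have lam_le (i j : nat) : (i <= j)%N -> (j < n)%N -> lam`_i <= lam`_j.
  move=> ij jn; apply: (sorted_leq_nth le_trans le_refl 0 lam_sorted) => //.
    by rewrite inE lam_size (leq_ltn_trans ij).
  by rewrite inE lam_size.
(* If no eigenvalue vanished, [sdeg], which A_sym fixes, would be orthogonal to every eigenvector,
   against completeness. Order and non-negativity place the zero eigenvalue at index 0. *)
have lam0 : lam`_0 = 0.
  have [l l0] : exists l : 'I_n, lam`_l = 0.
    apply: contrapT => /forallNP nl.
    have proj0 (l : 'I_n) : \sum_i psi l i * sdeg i = 0.
      apply: (mulfI (x := lam`_l)); first exact/eqP/nl.
      rewrite mulr0; apply/eqP; rewrite -oppr_eq0 -subr_eq0; apply/eqP.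
      have E : \sum_i psi l i * sdeg i = (1 - lam`_l) * \sum_i psi l i * sdeg i.
        rewrite {1}(eq_bigr (fun i => \sum_j psi l i * (A_sym R e i j * sdeg j))).
          rewrite exchange_big mulr_sumr /=; apply: eq_bigr => j _.
          rewrite mulrA -Apsi mulr_suml; apply: eq_bigr => i _.
          rewrite A_symC; ring.
        by move=> i _; rewrite -mulr_sumr A_sym_sdeg.
      rewrite mulrBl mul1r in E; lra.
    have := sdeg_gt0 (Ordinal n_gt1); rewrite lt_neqAle => /andP[/eqP + _].
    apply; set i := Ordinal _.
    transitivity (\sum_v (i == v)%:R * sdeg v).
      under eq_bigr do rewrite -complete mulr_suml.
      rewrite exchange_big big1 // => l _.
      by under eq_bigr do rewrite -mulrA; rewrite -mulr_sumr proj0 mulr0.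
    rewrite (bigD1 i) // eqxx mul1r big1 => [|v vi]; first exact: addr0.
    by rewrite eq_sym (negbTE vi) mul0r.
  have /andP[lam0_ge0 _] := lam_bd (Ordinal (ltnW n_gt1)).
  have := lam_le 0%N l (leq0n l) (ltn_ord l); rewrite l0 => lam0_le0.
  by apply/eqP; rewrite eq_le lam0_le0.
have kn0 (l : 'I_n) k : (forall i, psi l i = k * sdeg i) ->
    k ^+ 2 * (2 * (num_edges e)%:R) = 1.
  move=> kE; rewrite -sum_deg mulr_sumr -[RHS](sqsum l); apply: eq_bigr => i _.
  by rewrite kE exprMn sqr_sdeg.
split => //.
(* The zero eigenvalue is simple: two kernel vectors are nonzero multiples of [sdeg] and cannot be
   orthogonal. *)
- pose l0 := Ordinal (ltnW n_gt1); pose l1 := Ordinal n_gt1.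
  have /andP[+ _] := lam_bd l1; rewrite le_eqVlt => /orP[/eqP l1E|//].
  have [k0 k0E] := kernel l0 lam0; have [k1 k1E] := kernel l1 (esym l1E).
  have := orth l0 l1; rewrite (eq_bigr (fun i => k0 * k1 * (deg e i)%:R)); last first.
    by move=> i _; rewrite k0E k1E -sqr_sdeg; ring.
  rewrite -mulr_sumr sum_deg => /eqP; rewrite mulf_eq0.
  have H0 := kn0 _ _ k0E; have H1 := kn0 _ _ k1E.
  case/orP => [/eqP k01|/eqP E0].
    have : (k0 ^+ 2 * (2 * (num_edges e)%:R)) * (k1 ^+ 2 * (2 * (num_edges e)%:R)) = 1.
      by rewrite H0 H1 mulr1.
    have -> : (k0 ^+ 2 * (2 * (num_edges e)%:R)) * (k1 ^+ 2 * (2 * (num_edges e)%:R)) =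
       (k0 * k1) ^+ 2 * (2 * (num_edges e)%:R) ^+ 2 :> R by ring.
    by rewrite k01 expr0n mul0r => /eqP; rewrite eq_sym oner_eq0.
  by move: H0; rewrite E0 mulr0 => /eqP; rewrite eq_sym oner_eq0.
- by move=> l l0; apply: lam_le.
- move=> l v u l0; have [k kE] := kernel l (etrans (congr1 (nth 0 lam) l0) lam0).
  rewrite !kE; have := kn0 _ _ kE; have := num_edges_gt0.
  move: (num_edges e)%:R => E E0 H.
  have -> : k * sdeg v * (k * sdeg u) = k ^+ 2 * (sdeg v * sdeg u) by ring.
  rewrite -[k ^+ 2](mulfK (x := 2 * E)) ?H ?mul1r 1?mulrC //.
  by rewrite mulf_neq0 ?pnatr_eq0 // gt_eqF.
Qed.

End GraphSpectrum.

(** * Commute time *)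

Section HittingTime.
Variables (R : realType) (n : nat) (e : rel 'I_n) (lam : seq R).
Hypotheses (simple_e : simple_graph e) (conn_e : connected_graph e)
  (n_gt1 : (1 < n)%N).
Variable psi : 'I_n -> 'I_n -> R.
Hypothesis psiP : laplacian_eigenbasis e lam psi.

Definition step (x z : 'I_n) : R := (e x z)%:R / (deg e x)%:R.

(* Pseudo-inverse of the normalized Laplacian. *)
Definition green (x y : 'I_n) : R :=
  \sum_(l < n | (0 < l)%N) psi l x * psi l y / lam`_l.

(* Expected time for the walk started at [x] to reach [y]. *)
Definition hitting (y x : 'I_n) : R :=
  2 * (num_edges e)%:R *
    (green y y / (deg e y)%:R - green x y / (sdeg R e x * sdeg R e y)).

Let s := sdeg R e.
Let E : R := (num_edges e)%:R.

Let s_neq0 x : s x != 0.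
Proof. by rewrite gt_eqF // sdeg_gt0. Qed.

Let E_neq0 : E != 0.
Proof. by rewrite gt_eqF // num_edges_gt0. Qed.

Let lam_gt0 (l : 'I_n) : (0 < l)%N -> 0 < lam`_l.
Proof.
by move=> l0; apply: lt_le_trans (eigen1_gt0 psiP) (eigen_ge1 psiP l0).
Qed.

Lemma sum_step x : \sum_z step x z = 1.
Proof.
rewrite /step -mulr_suml -natr_deg divff // pnatr_eq0 -lt0n.
exact: deg_gt0.
Qed.

Lemma step_ge0 x z : 0 <= step x z.
Proof. by rewrite divr_ge0. Qed.

Lemma step_A_sym x z : step x z = A_sym R e x z * s z / s x.
Proof.
by rewrite A_symE /step -(sqr_sdeg R e) -/s; field; rewrite !s_neq0.
Qed.

Lemma sum_pos_eigen x y :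
  \sum_(l < n | (0 < l)%N) psi l x * psi l y = (x == y)%:R - s x * s y / (2 * E).
Proof.
pose l0 := Ordinal (ltnW n_gt1).
rewrite -(eigen_complete psiP) -(eigen_ground psiP x y (l := l0)) //.
rewrite [in RHS](bigD1 l0) //= [RHS]addrC addKr; apply: eq_bigl => l.
by rewrite -val_eqE /= lt0n.
Qed.

(** I - A_sym applied to [green] gives the projection off the ground state, whose entry is the
    bracket on the right. *)
Lemma A_sym_green x y : \sum_z A_sym R e x z * green z y =
  green x y - ((x == y)%:R - s x * s y / (2 * E)).
Proof.
rewrite -sum_pos_eigen -sumrB /green.
under eq_bigr do rewrite mulr_sumr.
rewrite exchange_big /=; apply: eq_bigr => l l0.
have Apsi := A_sym_eigenvector (eigen_orth psiP) (eigen_A_sym psiP) l x.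
rewrite (eq_bigr (fun z => (A_sym R e x z * psi l z) * (psi l y / lam`_l))).
  rewrite -mulr_suml Apsi; field.
  by rewrite gt_eqF // lam_gt0.
by move=> z _; ring.
Qed.

Lemma hitting_self y : hitting y y = 0.
Proof. by rewrite /hitting -expr2 sqr_sdeg subrr mulr0. Qed.

(** Off the diagonal the projection entry is - s x * s y / (2 * E), and the normalisation of
    [hitting] turns exactly this into the 1 of the one-step equation. *)
Lemma hitting_step y x : x != y ->
  hitting y x = 1 + \sum_z step x z * hitting y z.
Proof.
move=> xy.
have -> : \sum_z step x z * hitting y z =
    2 * E * (green y y / (deg e y)%:R) -
    2 * E / (s x * s y) * \sum_z A_sym R e x z * green z y.
  have -> : 2 * E * (green y y / (deg e y)%:R) =
      \sum_z step x z * (2 * E * (green y y / (deg e y)%:R)).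
    by rewrite -mulr_suml sum_step mul1r.
  rewrite mulr_sumr -sumrB.
  apply: eq_bigr => z _; rewrite /hitting -/E -/s step_A_sym.
  by field; rewrite !s_neq0 pnatr_eq0 -lt0n deg_gt0.
rewrite A_sym_green (negbTE xy) sub0r opprK /hitting -/E -/s.
by field; rewrite !s_neq0 E_neq0 pnatr_eq0 -lt0n deg_gt0.
Qed.

(* Minimum principle: [hitting y] cannot attain its minimum off [y], since
   there it exceeds an average of its values by 1. *)
Lemma hitting_ge0 y x : 0 <= hitting y x.
Proof.
pose x0 := [arg min_(z < y) hitting y z]%O.
have x0P z : hitting y x0 <= hitting y z.
  by rewrite /x0; case: arg_minP => // i _; apply.
have [x0y|x0y] := eqVneq x0 y; first by rewrite -(hitting_self y); have := x0P x; rewrite x0y.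
have : 1 + hitting y x0 <= hitting y x0.
  rewrite {2}(hitting_step x0y) lerD2l -[X in X <= _]mul1r -(sum_step x0).
  by rewrite mulr_suml; apply: ler_sum => z _; rewrite ler_wpM2l ?step_ge0.
by lra.
Qed.

Lemma hitting_commute u v : hitting u v + hitting v u =
  2 * E * (green u u / s u ^+ 2 + green v v / s v ^+ 2 -
           2 * green v u / (s v * s u)).
Proof.
have gC : green u v = green v u by apply: eq_bigr => l _; congr (_ / _); rewrite mulrC.
by rewrite /hitting gC -!(sqr_sdeg R e) -/s -/E; field; rewrite !s_neq0.
Qed.

End HittingTime.

(** * Upper bound on the expected commute time *)

Section CommuteTimeBound.
Variables (R : realType) (n : nat) (e : rel 'I_n) (v u : 'I_n).
Variable hit : 'I_n -> 'I_n -> R.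
Hypotheses (hit_self : forall y, hit y y = 0)
  (hit_ge0 : forall y x, 0 <= hit y x)
  (hit_step : forall y x, x != y ->
     hit y x = 1 + \sum_z step R e x z * hit y z)
  (sum_step1 : forall x, \sum_z step R e x z = 1).

(* Paths with k steps, as left-nested pairs: sums over paths of length k + 1
   then split definitionally over the last step. *)
Fixpoint path_type (k : nat) : finType :=
  if k is k'.+1 then (path_type k' * 'I_n)%type : finType else 'I_n : finType.

Fixpoint endpoint k : path_type k -> 'I_n :=
  if k is k'.+1 then fun p => p.2 else fun p => p.

Fixpoint traj (s : nat -> 'I_n) k : path_type k :=
  if k is k'.+1 then (traj s k', s k) else s 0%N.

Fixpoint weight k : path_type k -> R :=
  if k is k'.+1 then fun p => weight p.1 * step R e (endpoint p.1) p.2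
  else fun p => (p == v)%:R.

Fixpoint visited k : path_type k -> bool :=
  if k is k'.+1 then fun p => visited p.1 || (p.2 == u) else fun p => p == u.

Fixpoint finished k : path_type k -> bool :=
  if k is k'.+1 then
    fun p => finished p.1 || ((visited p.1 || (p.2 == u)) && (p.2 == v))
  else fun p => (p == u) && (p == v).

(* Expected remaining time before the walk has visited [u] and is back at [v]. *)
Definition lyapunov k (p : path_type k) : R :=
  if visited p then hit v (endpoint p) else hit u (endpoint p) + hit v u.

Let step_ge0' x z : 0 <= step R e x z.
Proof. by rewrite divr_ge0. Qed.

Lemma weight_ge0 k (p : path_type k) : 0 <= weight p.
Proof. by elim: k p => //= k IH p; rewrite mulr_ge0. Qed.

Lemma lyapunov_ge0 k (p : path_type k) : 0 <= lyapunov p.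
Proof. by rewrite /lyapunov; case: ifP; rewrite ?addr_ge0. Qed.

Lemma visited_unfinished k (p : path_type k) :
  visited p -> ~~ finished p -> endpoint p != v.
Proof.
case: k p => [|k] p /= => [->//|vp].
by rewrite vp /= negb_or => /andP[].
Qed.

Lemma unvisited_endpoint k (p : path_type k) : ~~ visited p -> endpoint p != u.
Proof. by case: k p => //= k p; rewrite negb_or => /andP[]. Qed.

(** The one-step equation of [hit] lowers the mean by 1 in both phases. The phases fit together on
    arrival at [u] because [hit u u] = 0, and dropping finished paths only lowers a non-negative
    quantity. *)
Lemma lyapunov_step k (p : path_type k) : ~~ finished p ->
  1 + \sum_y step R e (endpoint p) y *
        ((~~ finished ((p, y) : path_type k.+1))%:R *
         lyapunov ((p, y) : path_type k.+1)) <= lyapunov p.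
Proof.
move=> fp.
pose next y := if visited p then hit v y else hit u y + hit v u.
have nextP y : (~~ finished ((p, y) : path_type k.+1))%:R *
    lyapunov ((p, y) : path_type k.+1) <= next y.
  apply: (@le_trans _ _ (lyapunov ((p, y) : path_type k.+1))).
    by rewrite ler_piMl ?lyapunov_ge0 // lern1 leq_b1.
  rewrite /lyapunov /next /=; case: (visited p) => //=.
  by have [->|_] := eqVneq y u => //; rewrite hit_self add0r.
apply: (@le_trans _ _ (1 + \sum_y step R e (endpoint p) y * next y)).
  by rewrite lerD2l; apply: ler_sum => y _; rewrite ler_wpM2l.
rewrite /next /lyapunov; have [vp|vp] := ifPn.
  by rewrite (hit_step (visited_unfinished vp fp)).
rewrite (hit_step (unvisited_endpoint vp)) -addrA lerD2l.
under eq_bigr do rewrite mulrDr.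
by rewrite big_split /= -mulr_suml sum_step1 mul1r.
Qed.

(** The probability that the commute is not completed by time k; these tails sum to the expected
    commute time. *)
Definition survival k : R := \sum_(p : path_type k) (~~ finished p)%:R * weight p.
Definition potential k : R :=
  \sum_(p : path_type k) (~~ finished p)%:R * weight p * lyapunov p.

Lemma potential_ge0 k : 0 <= potential k.
Proof. by apply: sumr_ge0 => p _; rewrite !mulr_ge0 ?lyapunov_ge0 ?weight_ge0. Qed.

Lemma potential_step k : survival k + potential k.+1 <= potential k.
Proof.
rewrite /survival /potential /=.
rewrite -(pair_bigA _ (fun p y => (~~ finished ((p, y) : path_type k.+1))%:R *
  weight ((p, y) : path_type k.+1) * lyapunov ((p, y) : path_type k.+1))) /=.
rewrite -big_split /=; apply: ler_sum => p _.
have [fp|fp] := boolP (finished p).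
  by rewrite !mul0r add0r big1 // => y _; rewrite !mul0r.
rewrite !mul1r; apply: le_trans (ler_wpM2l (weight_ge0 p) (lyapunov_step fp)).
rewrite mulrDr mulr1 lerD2l mulr_sumr; apply: ler_sum => y _ /=.
rewrite (negbTE fp) /= le_eqVlt; apply/orP; left; apply/eqP; ring.
Qed.

(** Telescoping of [potential_step]. Initially all weight sits on [v], where the potential is the
    right-hand side, or 0 if [v] = [u], since the commute is then already finished. *)
Lemma sum_survival K : \sum_(0 <= k < K) survival k <= hit u v + hit v u.
Proof.
have H : \sum_(0 <= k < K) survival k + potential K <= potential 0.
  elim: K => [|K IH]; first by rewrite big_nil add0r.
  apply: le_trans IH; rewrite big_nat_recr //= -addrA lerD2l.
  exact: potential_step.
apply: (@le_trans _ _ (potential 0)).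
  by apply: le_trans H; rewrite lerDl potential_ge0.
rewrite /potential (bigD1 v) //= big1 => [|x xv]; last first.
  by rewrite (negbTE xv) mulr0 mul0r.
rewrite addr0 eqxx mulr1 andbT; have [_|vu] := boolP (v == u).
  by rewrite mul0r addr_ge0.
by rewrite mul1r /lyapunov /= (negbTE vu).
Qed.

Section Walk.
Variables (disp : measure_display) (Om : measurableType disp)
  (P : probability Om R) (S : nat -> Om -> 'I_n).
Hypothesis walkS : simple_random_walk e P S v.

Let cylinder k (p : path_type k) := [set w | traj (S^~ w) k = p].

(** Turns a path into a sequence, the form in which [simple_random_walk] gives the joint law; only
    the values up to time k are compared. *)
Fixpoint path_fun k : path_type k -> nat -> 'I_n :=
  if k is k'.+1 then fun p i => if i == k then p.2 else path_fun p.1 i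
  else fun p _ => p.

Lemma path_fun_endpoint k (p : path_type k) : path_fun p k = endpoint p.
Proof. by case: k p => //= k p; rewrite eqxx. Qed.

Lemma traj_eqP k (s : nat -> 'I_n) (p : path_type k) :
  traj s k = p <-> forall i, (i <= k)%N -> s i = path_fun p i.
Proof.
elim: k p => [|k IH] p /=.
  by split=> [<- i|]; [rewrite leqn0 => /eqP ->|apply].
split=> [<- i /=|H].
  rewrite leq_eqVlt; case: eqP => [->//|_ /=]; rewrite ltnS => ik.
  exact: (IH (traj s k)).1.
case: p H => p y H; congr (_, _).
  apply/IH => i ik; rewrite (H i (leqW ik)) /=.
  by rewrite (ltn_eqF (leq_ltn_trans ik (ltnSn k))).
by rewrite (H k.+1) //= eqxx.
Qed.

Lemma cylinder_measurable k (p : path_type k) : measurable (cylinder p).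
Proof.
elim: k p => [|k IH] p; first by apply: walkS.1.
case: p => p y; rewrite (_ : cylinder _ = cylinder p `&` S k.+1 @^-1` [set y]).
  by apply: measurableI => //; apply: walkS.1.
apply/seteqP; split=> w /=; first by case.
by rewrite /cylinder /= => -[-> ->].
Qed.

Lemma cylinder_prob k (p : path_type k) : P (cylinder p) = (weight p)%:E.
Proof.
have -> : cylinder p =
      [set w | forall i : nat, (i <= k)%N -> S i w = path_fun p i].
  by apply/seteqP; split=> w; [move/traj_eqP|move=> H; apply/traj_eqP].
rewrite walkS.2; congr _%:E; elim: k p => [|k IH] p /=.
  by rewrite big_ord0 mulr1.
rewrite big_ord_recr /= mulrA -IH eqxx.
rewrite (ltn_eqF (ltnSn k)) path_fun_endpoint; congr (_ * _ * _).
apply: eq_bigr => i _; rewrite (ltn_eqF (leqW (ltn_ord i))).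
by rewrite (ltn_eqF (_ : i.+1 < k.+1)%N) ?ltnS.
Qed.

Let alive k w : \bar R := ((~~ finished (traj (S^~ w) k))%:R)%:E.

(** A finite combination of cylinder indicators, which yields both the measurability and the
    integral of [alive k]. *)
Let aliveE k : alive k = fun w => (\sum_(p : path_type k)
  ((~~ finished p)%:R)%:E * (\1_(cylinder p) w)%:E)%E.
Proof.
apply/funext => w; rewrite (bigD1 (traj (S^~ w) k)) //= big1 => [|p pk].
  by rewrite indicE mem_set // mule1 adde0.
rewrite indicE memNset ?mule0 // /cylinder /= => E.
by rewrite E eqxx in pk.
Qed.

Let measurable_term k (p : path_type k) :
  measurable_fun setT ((fun w => ((~~ finished p)%:R)%:E *
    (\1_(cylinder p) w)%:E)%E : Om -> \bar R).
Proof.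
apply: emeasurable_funM; first exact: measurable_cst.
apply/measurable_EFinP; apply: measurable_indic.
exact: cylinder_measurable.
Qed.

Lemma measurable_alive k : measurable_fun setT (alive k).
Proof. by rewrite aliveE; apply: emeasurable_sum => p; apply: measurable_term. Qed.

Lemma alive_ge0 k w : (0 <= alive k w)%E.
Proof. by rewrite lee_fin. Qed.

Lemma integral_alive k : (\int[P]_w alive k w = (survival k)%:E)%E.
Proof.
rewrite aliveE ge0_integral_sum => [|//|p|p w _]; first last.
- by rewrite mule_ge0 ?lee_fin.
- exact: measurable_term.
rewrite /survival -sumEFin; apply: eq_bigr => p _.
rewrite ge0_integralZl_EFin //; last first.
  by apply/measurable_EFinP; apply: measurable_indic; apply: cylinder_measurable.
rewrite integral_indic ?setIT //; last exact: cylinder_measurable.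
rewrite EFinM; congr (_ * _)%E; exact: cylinder_prob.
Qed.

Lemma visitedP s k : visited (traj s k) <-> exists2 j, (j <= k)%N & s j = u.
Proof.
elim: k => [|k IH] /=.
  split=> [/eqP E|[j]]; first by exists 0%N.
  by rewrite leqn0 => /eqP -> ->.
split=> [/orP[/IH[j jk E]|/eqP E]|[j]].
- by exists j => //; apply: leqW.
- by exists k.+1.
- rewrite leq_eqVlt => /orP[/eqP -> ->|jk E]; first by rewrite eqxx orbT.
  by apply/orP; left; apply/IH; exists j.
Qed.

Lemma finishedP s k : finished (traj s k) <->
  exists k', [/\ (k' <= k)%N, s k' = v & exists2 j, (j <= k')%N & s j = u].
Proof.
elim: k => [|k IH] /=.
  split=> [/andP[/eqP su /eqP sv]|[k' []]].
    by exists 0%N; split=> //; exists 0%N.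
  rewrite leqn0 => /eqP -> sv [j]; rewrite leqn0 => /eqP -> su.
  by apply/andP; split; apply/eqP.
split=> [/orP[/IH[k' [k'k ? ?]]|/andP[vk /eqP sv]]|[k' []]].
- by exists k'; split=> //; apply: leqW.
- by exists k.+1; split=> //; apply/(visitedP s k.+1).
- rewrite leq_eqVlt => /orP[/eqP -> sv su|k'k sv su].
    by apply/orP; right; rewrite sv eqxx andbT -sv; apply/(visitedP s k.+1).
  by apply/orP; left; apply/IH; exists k'.
Qed.

(** Pathwise tail sum: before the first K at which the commute is finished all K terms equal 1, and
    if there is no such K the series diverges. *)
Lemma commute_steps_le w :
  (commute_steps R v u (S^~ w) <= \sum_(0 <= k <oo) alive k w)%E.
Proof.
have partial K : (forall k, (k < K)%N -> ~~ finished (traj (S^~ w) k)) ->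
    ((K%:R)%:E <= \sum_(0 <= k <oo) alive k w)%E.
  move=> aliveK; apply: le_trans (nneseries_lim_ge K _); last first.
    by move=> k _ _; apply: alive_ge0.
  rewrite (eq_big_nat _ _ (F2 := fun=> 1%:E)) => [|k /andP[_ kK]].
    by rewrite sumEFin big_const_nat iter_addr_0 subn0.
  by rewrite /alive aliveK.
have [fin|nofin] := pselect (exists k, finished (traj (S^~ w) k)).
  have [K /finishedP[K' [K'K sv su]] Kmin] := ex_minnP fin.
  apply: (@le_trans _ _ (K%:R)%:E).
    apply: (@le_trans _ _ (K'%:R)%:E); last by rewrite lee_fin ler_nat.
    by apply: ereal_inf_lbound; exists K'.
  apply: partial => k kK; apply/negP => /Kmin.
  by rewrite leqNgt kK.
rewrite (_ : (\sum_(0 <= k <oo) alive k w)%E = +oo%E) ?leey //.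
apply: eq_infty => r; apply: le_trans (partial (Num.truncn r).+1 _).
  by rewrite lee_fin ltW // truncnS_gt.
by move=> k _; apply/negP => fk; apply: nofin; exists k.
Qed.

Lemma commute_steps_ge0 w : (0 <= commute_steps R v u (S^~ w))%E.
Proof. by apply: le_ereal_inf_tmp => _ [k _ <-]; rewrite lee_fin. Qed.

Lemma commute_time_ge0 : (0 <= commute_time P S v u)%E.
Proof. by apply: integral_ge0 => w _; apply: commute_steps_ge0. Qed.

Lemma commute_time_le : (commute_time P S v u <= (hit u v + hit v u)%:E)%E.
Proof.
have series_ge0 w : (0 <= \sum_(0 <= k <oo) alive k w)%E.
  by apply: nneseries_ge0 => k _ _; apply: alive_ge0.
apply: (@le_trans _ _ (\int[P]_w \sum_(0 <= k <oo) alive k w)%E).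
  (* The integral of a non-negative function is a supremum over simple functions below it, hence
     monotone without measurability of [commute_steps]. *)
  rewrite /commute_time !ge0_integralTE //; last by move=> w; apply: commute_steps_ge0.
  apply: le_ereal_sup => _ [h hle <-]; exists h => // w.
  exact: le_trans (hle w) (commute_steps_le w).
rewrite integral_nneseries => [|//|k|k w _]; first last.
- exact: alive_ge0.
- exact: measurable_alive.
under eq_eseriesr do rewrite integral_alive.
apply: lime_le.
  apply: is_cvg_nneseries => k _ _; rewrite lee_fin.
  by apply: sumr_ge0 => p _; rewrite mulr_ge0 ?weight_ge0.
by apply: nearW => K; rewrite sumEFin lee_fin sum_survival.
Qed.

End Walk.

End CommuteTimeBound.

(** * Sums of powers of I - c2 (I - A_sym) *)

Section DegreeRatio.
Variables (R : realType) (n : nat) (e : rel 'I_n).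
Hypotheses (conn_e : connected_graph e) (n_gt1 : (1 < n)%N).

Lemma deg_min_le i : (deg_min e <= deg e i)%N.
Proof.
have : i \in index_enum 'I_n by apply: mem_index_enum.
rewrite /deg_min; elim: (index_enum _) => // j r IH.
rewrite big_cons in_cons => /orP[/eqP ->|ir]; first exact: geq_minl.
by apply: leq_trans (IH ir); apply: geq_minr.
Qed.

Lemma deg_min_gt0 : (0 < deg_min e)%N.
Proof.
rewrite /deg_min; elim/big_ind : _ => [|x y x0 y0|i _]; first exact: ltnW.
  by rewrite leq_min x0.
exact: deg_gt0.
Qed.

Lemma sdeg_le_ratio i j : sdeg R e i <= deg_ratio R e * sdeg R e j.
Proof.
rewrite /sdeg /deg_ratio -sqrtrM ?divr_ge0 // ler_wsqrtr //.
have dmin0 : 0 < (deg_min e)%:R :> R by rewrite ltr0n deg_min_gt0.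
rewrite mulrAC ler_pdivlMr //; apply: ler_pM => //; rewrite ler_nat.
  exact: leq_bigmax.
exact: deg_min_le.
Qed.

Lemma deg_ratio_ge1 : 1 <= deg_ratio R e.
Proof.
have s0 := sdeg_gt0 R conn_e n_gt1 (Ordinal n_gt1).
by rewrite -(ler_pM2r s0) mul1r sdeg_le_ratio.
Qed.

(** Multiply by the least entry of [sdeg]: the left side is then at most the i-th entry of A_sym
    applied to [sdeg], which is [sdeg i], and this is at most the ratio times that least entry. *)
Lemma sum_A_sym_le i : simple_graph e ->
  \sum_j A_sym R e i j <= deg_ratio R e.
Proof.
move=> simple_e.
pose j0 := [arg min_(z < i) sdeg R e z]%O.
have j0P z : sdeg R e j0 <= sdeg R e z.
  by rewrite /j0; case: arg_minP => // k _; apply.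
have s0 := sdeg_gt0 R conn_e n_gt1 j0.
rewrite -(ler_pM2r s0) mulr_suml.
apply: le_trans (sdeg_le_ratio i j0); rewrite -[X in _ <= X]A_sym_sdeg //.
by apply: ler_sum => j _; rewrite ler_wpM2l ?A_sym_ge0.
Qed.

(** On the left the weights are replaced by their minimum, on the right by the ratio times this
    minimum. *)
Lemma weighted_sum_le (x y : 'I_n -> R) :
  (forall i, 0 <= x i) -> (forall i, 0 <= y i) ->
  \sum_i sdeg R e i * x i <= \sum_i sdeg R e i * y i ->
  \sum_i x i <= deg_ratio R e * \sum_i y i.
Proof.
move=> x0 y0 xy.
pose j0 := [arg min_(z < Ordinal n_gt1) sdeg R e z]%O.
have j0P z : sdeg R e j0 <= sdeg R e z.
  by rewrite /j0; case: arg_minP => // k _; apply.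
have s0 := sdeg_gt0 R conn_e n_gt1 j0.
rewrite -(ler_pM2l s0) mulr_sumr.
apply: (@le_trans _ _ (\sum_i sdeg R e i * x i)).
  by apply: ler_sum => i _; rewrite ler_wpM2r.
apply: le_trans xy _; rewrite mulrA mulr_sumr; apply: ler_sum => i _.
by rewrite ler_wpM2r // mulrC sdeg_le_ratio.
Qed.

End DegreeRatio.

Section LazyWalkPowers.
Variables (R : realType) (n : nat) (e : rel 'I_n) (lam : seq R).
Hypotheses (simple_e : simple_graph e) (conn_e : connected_graph e)
  (n_gt1 : (1 < n)%N).
Variable psi : 'I_n -> 'I_n -> R.
Hypothesis psiP : laplacian_eigenbasis e lam psi.
Variable c2 : R.
Hypotheses (c2_gt0 : 0 < c2) (c2_le1 : c2 <= 1).

Let A := A_sym R e.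
Let s := sdeg R e.
Let E : R := (num_edges e)%:R.

(* Entry (v, u) of T^k, where T = I - c2 (I - A_sym). *)
Definition pw (k : nat) (v u : 'I_n) : R :=
  \sum_(l < n) (1 - c2 * lam`_l) ^+ k * (psi l v * psi l u).

(* Entry (v, u) of A_sym T^k. *)
Definition apw (k : nat) (v u : 'I_n) : R :=
  \sum_(l < n) (1 - lam`_l) * (1 - c2 * lam`_l) ^+ k * (psi l v * psi l u).

Lemma pw0 v u : pw 0 v u = (v == u)%:R.
Proof.
by rewrite -(eigen_complete psiP); apply: eq_bigr => l _; rewrite expr0 mul1r.
Qed.

Lemma pw_recr k v u : pw k.+1 v u = (1 - c2) * pw k v u + c2 * apw k v u.
Proof.
rewrite /pw /apw !mulr_sumr -big_split /=; apply: eq_bigr => l _.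
rewrite exprS; ring.
Qed.

Lemma sum_A_pw k i u : \sum_j A i j * pw k j u = apw k i u.
Proof.
under eq_bigr do rewrite mulr_sumr; rewrite exchange_big /=.
apply: eq_bigr => l _.
have Apsi := A_sym_eigenvector (eigen_orth psiP) (eigen_A_sym psiP) l i.
rewrite (eq_bigr (fun j => (A i j * psi l j) *
    ((1 - c2 * lam`_l) ^+ k * psi l u))) => [|j _]; last by ring.
by rewrite -mulr_suml Apsi; ring.
Qed.

(** The spectral formula hides the sign; the recurrence shows it, as [c2] is at most 1 and A_sym has
    non-negative entries. *)
Lemma pw_ge0 k v u : 0 <= pw k v u.
Proof.
elim: k v => [|k IH] v; first by rewrite pw0.
rewrite pw_recr -sum_A_pw addr_ge0 ?mulr_ge0 ?subr_ge0 ?(ltW c2_gt0) //.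
by apply: sumr_ge0 => j _; rewrite mulr_ge0 ?A_sym_ge0.
Qed.

Lemma apw_ge0 k v u : 0 <= apw k v u.
Proof.
by rewrite -sum_A_pw; apply: sumr_ge0 => j _; rewrite mulr_ge0 ?A_sym_ge0 ?pw_ge0.
Qed.

Lemma pw_conv a b v u : \sum_i pw a i v * pw b i u = pw (a + b) v u.
Proof.
pose x (l : 'I_n) := 1 - c2 * lam`_l.
transitivity (\sum_l \sum_k x l ^+ a * x k ^+ b * (psi l v * psi k u) *
    \sum_i psi l i * psi k i).
  rewrite (eq_bigr (fun i => \sum_l \sum_k x l ^+ a * x k ^+ b *
      (psi l v * psi k u) * (psi l i * psi k i))).
    rewrite exchange_big /=; apply: eq_bigr => l _; rewrite exchange_big /=.
    by apply: eq_bigr => k _; rewrite mulr_sumr.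
  move=> i _; rewrite /pw mulr_suml; apply: eq_bigr => l _.
  rewrite mulr_sumr; apply: eq_bigr => k _; rewrite /x; ring.
apply: eq_bigr => l _; rewrite (bigD1 l) //= (eigen_orth psiP) eqxx mulr1 -exprD.
rewrite big1 => [|k kl]; first by rewrite addr0.
by rewrite (eigen_orth psiP) eq_sym (negbTE kl) mulr0.
Qed.

Lemma apw_conv a b v u :
  \sum_i \sum_j A i j * (pw a i v * pw b j u) = apw (a + b) v u.
Proof.
rewrite (eq_bigr (fun i => pw a i v * apw b i u)) => [|i _]; last first.
  by rewrite -sum_A_pw mulr_sumr; apply: eq_bigr => j _; ring.
(* From c2 A_sym = T - (1 - c2) I, which reduces the claim to [pw_conv]. *)
have apwE k x y : apw k x y = c2^-1 * (pw k.+1 x y - (1 - c2) * pw k x y).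
  by rewrite pw_recr; field; rewrite gt_eqF.
under eq_bigr do rewrite apwE mulrCA mulrBr [pw a _ v * (_ * _)]mulrCA.
rewrite -mulr_sumr sumrB -mulr_sumr !pw_conv apwE.
by rewrite addnS.
Qed.

Lemma pw_walk k v u : pw k v u != 0 ->
  exists p, [/\ path e v p, last v p = u & (size p <= k)%N].
Proof.
elim: k v => [|k IH] v.
  rewrite pw0; case: (v =P u) => [-> _|_]; first by exists [::].
  by rewrite eqxx.
rewrite pw_recr -sum_A_pw.
have [pk0|/IH[p [? ? ?]] _] := eqVneq (pw k v u) 0; last first.
  by exists p; split=> //; apply: leqW.
rewrite pk0 mulr0 add0r mulf_eq0 negb_or => /andP[_ nz].
have [j] : exists j, A v j * pw k j u != 0.
  apply/existsP; apply: contraNT nz => /existsPn nz.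
  by rewrite big1 // => j _; apply/eqP; move: (nz j); rewrite negbK.
rewrite mulf_eq0 negb_or => /andP[Avj /IH[p [ep lp sp]]].
exists (j :: p); split=> //=; rewrite ep andbT.
by apply: contraNT Avj => /negbTE evj; rewrite /A A_symE evj mul0r.
Qed.

Lemma pw_lt_dist k v u : (k < graph_dist e v u)%N -> pw k v u = 0.
Proof.
move=> kr; apply/eqP; apply: contraLR kr => /pw_walk[p [ep lp sp]].
rewrite -leqNgt; apply: leq_trans sp; rewrite leqNgt; apply/negP => pr.
have := before_find 0%N pr.
(* [graph_dist] only searches lengths below n; by [pr] the length of [p] is below the index found,
   hence in the searched range. *)
have pn : (size p < n)%N.
  by apply: leq_trans pr _; rewrite -{2}(size_iota 0 n) find_size.
rewrite nth_iota // => /existsP[]; exists (in_tuple p).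
by rewrite ep lp eqxx.
Qed.

Lemma graph_dist_eq0 v u : graph_dist e v u = 0%N -> v = u.
Proof.
rewrite /graph_dist; case: n n_gt1 v u e => // n' _ v' u' e' /=.
case: ifP => // /existsP[p /andP[_]]; rewrite (tuple0 p) /= => /eqP //.
Qed.

Let x (l : 'I_n) := 1 - c2 * lam`_l.
Let lam_gt0 (l : 'I_n) : (0 < l)%N -> 0 < lam`_l.
Proof.
by move=> l0; apply: lt_le_trans (eigen1_gt0 psiP) (eigen_ge1 psiP l0).
Qed.
Let lam1_gt0 := eigen1_gt0 psiP.
Let s_gt0 i : 0 < s i.
Proof. exact: sdeg_gt0. Qed.
Let E_gt0 : 0 < E.
Proof. exact: num_edges_gt0. Qed.

Variables v u : 'I_n.
(** Twice the ground-state share of the (v, u) entry of any power of T, so that 2m consecutive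
    powers contribute m a. *)
Let a : R := s v * s u / E.

Let a_ge0 : 0 <= a.
Proof. by rewrite divr_ge0 ?mulr_ge0 ?ltW. Qed.

Let ground_term (F : 'I_n -> R) (c : R) :
  (forall l : 'I_n, l = 0 :> nat -> F l = c) ->
  \sum_l F l = c + \sum_(l < n | (0 < l)%N) F l.
Proof.
move=> Fc; pose l0 := Ordinal (ltnW n_gt1).
rewrite (bigD1 l0) //= Fc //; congr (_ + _); apply: eq_bigl => l.
by rewrite -val_eqE /= lt0n.
Qed.

Let ground_vu (l : 'I_n) : l = 0 :> nat -> psi l v * psi l u = a / 2.
Proof.
move=> l0; rewrite (eigen_ground psiP) // /a -/s -/E; field.
by rewrite gt_eqF.
Qed.

Lemma sum_abs_le1 : \sum_l `|psi l v * psi l u| <= 1.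
Proof.
apply: (@le_trans _ _ (\sum_l 2^-1 * (psi l v * psi l v + psi l u * psi l u))).
  apply: ler_sum => l _; move: (psi l v) (psi l u) => y z.
  rewrite normrM -!expr2 -(real_normK (num_real y)) -(real_normK (num_real z)).
  by move: (`|y|) (`|z|) => y' z'; have := sqr_ge0 (y' - z'); rewrite sqrrB; lra.
by rewrite -mulr_sumr big_split /= !(eigen_complete psiP) !eqxx /=; lra.
Qed.

Lemma sum_pos_abs_le : \sum_(l < n | (0 < l)%N) `|psi l v * psi l u| <= 1 - a / 2.
Proof.
rewrite lerBrDl -(ground_term (F := fun l => `|psi l v * psi l u|)).
  exact: sum_abs_le1.
by move=> l l0; rewrite ground_vu // ger0_norm // divr_ge0.
Qed.

Let x_le1 l : `|x l| <= 1.
Proof.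
have /andP[l0 l2] := eigen_le2 psiP l; rewrite ler_norml /x.
apply/andP; split; last by rewrite lerBlDr lerDl mulr_ge0 // ltW.
have : c2 * lam`_l <= 1 * 2 by apply: ler_pM => //; apply: ltW.
lra.
Qed.

Lemma pw_le1 k : pw k v u <= 1.
Proof.
apply: le_trans sum_abs_le1; apply: ler_sum => l _.
apply: le_trans (ler_norm _) _; rewrite normrM normrX.
rewrite ler_piMl // exprn_ile1 //; exact: x_le1.
Qed.

Let G := green lam psi v u.
Let rest k := \sum_(l < n | (0 < l)%N) x l ^+ k * (psi l v * psi l u / lam`_l).

Lemma sum_pw K : \sum_(0 <= k < K) pw k v u = K%:R * a / 2 + c2^-1 * (G - rest K).
Proof.
have x0 (l : 'I_n) : l = 0 :> nat -> x l = 1.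
  by move=> l0; rewrite /x l0 (eigen0 psiP) mulr0 subr0.
rewrite /pw exchange_big /=.
rewrite (ground_term (c := K%:R * a / 2)) => [|l l0]; last first.
  under eq_big_nat => k _ do rewrite -/(x l) x0 // expr1n mul1r ground_vu //.
  by rewrite big_const_nat iter_addr_0 subn0 -[LHS]mulr_natl mulrA.
congr (_ + _); rewrite /G /green /rest -sumrB mulr_sumr.
apply: eq_bigr => l l0; rewrite -mulr_suml -/(x l).
have geo : (\sum_(0 <= k < K) x l ^+ k) * (c2 * lam`_l) = 1 - x l ^+ K.
  have := subrX1 (x l) K; rewrite big_mkord => E0.
  have -> : c2 * lam`_l = - (x l - 1) by rewrite /x; ring.
  by rewrite mulrN mulrC -E0 opprB.
have -> : \sum_(0 <= k < K) x l ^+ k = (1 - x l ^+ K) / (c2 * lam`_l).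
  by rewrite -geo mulfK // mulf_neq0 ?gt_eqF // lam_gt0.
field.
by rewrite !gt_eqF // lam_gt0.
Qed.

Variables (rho gam : R).
Hypotheses (rho_le1 : rho <= 1)
  (rhoP : forall l : 'I_n, (0 < l)%N -> `|x l| <= rho)
  (gamP : forall i j, s i <= gam * s j).

Let rho_ge0 : 0 <= rho.
Proof. exact: le_trans (normr_ge0 _) (rhoP (l := Ordinal n_gt1) isT). Qed.

Lemma rest_le k : - rest k <= rho ^+ k * (1 - a / 2) / lam`_1.
Proof.
apply: le_trans (ler_norm _) _; rewrite normrN.
apply: le_trans (ler_norm_sum _ _ _) _.
apply: (@le_trans _ _ (\sum_(l < n | (0 < l)%N)
    rho ^+ k * (`|psi l v * psi l u| / lam`_1))).
  apply: ler_sum => l l0; rewrite normrM normrX.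
  apply: ler_pM; rewrite ?exprn_ge0 //.
    by apply: lerXn2r; rewrite ?nnegrE //; apply: rhoP.
  rewrite normrM ler_wpM2l // ger0_norm ?invr_ge0 ?(ltW (lam_gt0 l0)) //.
  by rewrite lef_pV2 ?posrE ?lam_gt0 // (eigen_ge1 psiP).
rewrite -mulr_sumr -mulr_suml mulrA ler_wpM2r ?invr_ge0 ?(ltW lam1_gt0) //.
by rewrite ler_wpM2l ?exprn_ge0 // sum_pos_abs_le.
Qed.

(** On the diagonal the terms are non-negative, so each eigenvalue may be replaced by the smallest
    positive one. The ground-state deficit is kept for later use. *)
Lemma green_diag_le y : green lam psi y y <= (1 - s y ^+ 2 / (2 * E)) / lam`_1.
Proof.
have -> : 1 - s y ^+ 2 / (2 * E) =
    \sum_(l < n | (0 < l)%N) psi l y * psi l y.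
  by rewrite (sum_pos_eigen n_gt1 psiP) eqxx expr2.
rewrite mulr_suml; apply: ler_sum => l l0.
rewrite ler_wpM2l -?expr2 ?sqr_ge0 //.
by rewrite lef_pV2 ?posrE ?lam_gt0 // (eigen_ge1 psiP).
Qed.

Let tau : R := 2 * E * (green lam psi u u / s u ^+ 2 + green lam psi v v / s v ^+ 2 -
           2 * green lam psi v u / (s v * s u)).

Let ratio_le y z : s y / s z <= gam.
Proof. by rewrite ler_pdivrMr. Qed.

Let tau_green : tau * a / 4 = 2^-1 *
  (s v / s u * green lam psi u u + s u / s v * green lam psi v v) - G.
Proof. by rewrite /tau /a /G; field; rewrite !gt_eqF. Qed.

(** [tau_green] solves the commute-time formula for the off-diagonal entry, whose terms have no
    sign. What remains are diagonal entries, with weights of at most [gam]. *)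
Lemma green_le : G <= - (tau * a / 4) + (gam - a / 2) / lam`_1.
Proof.
rewrite tau_green.
have du := green_diag_le u; have dv := green_diag_le v.
have svu : 0 < s v / s u by rewrite divr_gt0.
have suv : 0 < s u / s v by rewrite divr_gt0.
have H1 := ler_wpM2l (ltW svu) du; have H2 := ler_wpM2l (ltW suv) dv.
have R1 := ratio_le v u; have R2 := ratio_le u v.
have E1 : s v / s u * ((1 - s u ^+ 2 / (2 * E)) / lam`_1) =
    (s v / s u - a / 2) / lam`_1.
  by rewrite /a; field; rewrite !gt_eqF.
have E2 : s u / s v * ((1 - s v ^+ 2 / (2 * E)) / lam`_1) =
    (s u / s v - a / 2) / lam`_1.
  by rewrite /a; field; rewrite !gt_eqF.
rewrite E1 in H1; rewrite E2 in H2.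
have H3 : (s v / s u - a / 2) / lam`_1 <= (gam - a / 2) / lam`_1.
  by rewrite ler_pM2r ?invr_gt0 // lerD2r.
have H4 : (s u / s v - a / 2) / lam`_1 <= (gam - a / 2) / lam`_1.
  by rewrite ler_pM2r ?invr_gt0 // lerD2r.
move: H1 H2 H3 H4; lra.
Qed.

(** This is what makes [B] non-negative. Written as a sum of squares over the eigenvalues, the left
    side grows when each of these is replaced by the smallest positive one, and completeness then
    evaluates it. *)
Lemma tau_le : tau * a / 4 <= gam / lam`_1.
Proof.
have gl : 0 <= gam / lam`_1.
  by rewrite divr_ge0 ?ltW //; apply: lt_le_trans (ratio_le v v); rewrite divff ?gt_eqF.
have [vu|vu] := eqVneq v u.
  rewrite tau_green vu /G vu divff ?gt_eqF // !mul1r.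
  by move: gl; lra.
have -> : tau * a / 4 = \sum_(l < n | (0 < l)%N)
    s v * s u / 2 * (psi l v / s v - psi l u / s u) ^+ 2 / lam`_l.
  rewrite tau_green /G /green !mulr_sumr -big_split mulr_sumr -sumrB /=.
  apply: eq_bigr => l l0; field.
  by rewrite !gt_eqF // lam_gt0.
apply: (@le_trans _ _ (\sum_(l < n | (0 < l)%N)
    s v * s u / 2 * (psi l v / s v - psi l u / s u) ^+ 2 / lam`_1)).
  apply: ler_sum => l l0; rewrite ler_wpM2l //.
    by rewrite mulr_ge0 ?sqr_ge0 // !mulr_ge0 ?invr_ge0 // ltW.
  by rewrite lef_pV2 ?posrE ?lam_gt0 // (eigen_ge1 psiP).
rewrite -mulr_suml ler_wpM2r ?invr_ge0 ?(ltW lam1_gt0) //.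
rewrite (eq_bigr (fun l => 2^-1 * (s u / s v) * (psi l v * psi l v) +
    2^-1 * (s v / s u) * (psi l u * psi l u) - psi l v * psi l u)); last first.
  by move=> l _; field; rewrite !gt_eqF.
rewrite sumrB big_split /= -!mulr_sumr.
rewrite !(sum_pos_eigen n_gt1 psiP) !eqxx (negbTE vu) -/s -/E.
have R1 := ratio_le v u; have R2 := ratio_le u v.
have -> : 2^-1 * (s u / s v) * (true%:R - s v * s v / (2 * E)) +
    2^-1 * (s v / s u) * (true%:R - s u * s u / (2 * E)) -
    (false%:R - s v * s u / (2 * E)) = 2^-1 * (s u / s v + s v / s u).
  by rewrite /= mulr1n mulr0n; field; rewrite !gt_eqF.
by move: R1 R2; lra.
Qed.

(* Rayleigh quotient of the vector supported on {v, u} and orthogonal to the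
   ground state. *)
Lemma nonadjacent_lam1_le1 : v != u -> A v u = 0 -> lam`_1 <= 1.
Proof.
move=> vu Avu; have [_ irr] := simple_e.
have Aii i : A i i = 0 by rewrite /A A_symE irr mul0r.
have lamE y z : \sum_(l < n) lam`_l * (psi l y * psi l z) = (y == z)%:R - A y z.
  rewrite -(eigen_complete psiP) /A (eigen_A_sym psiP) -sumrB.
  by apply: eq_bigr => l _; ring.
pose f (l : 'I_n) := s u * psi l v - s v * psi l u.
have f0 (l : 'I_n) : l = 0 :> nat -> f l ^+ 2 = 0.
  move=> l0; have -> : f l ^+ 2 = s u ^+ 2 * (psi l v * psi l v) +
     s v ^+ 2 * (psi l u * psi l u) - 2 * s u * s v * (psi l v * psi l u).
    by rewrite /f; ring.
  rewrite !(eigen_ground psiP) // -/s -/E; field.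
  by rewrite gt_eqF.
have fsum (g : 'I_n -> R) : \sum_l g l * f l ^+ 2 =
    s u ^+ 2 * (\sum_l g l * (psi l v * psi l v)) +
    s v ^+ 2 * (\sum_l g l * (psi l u * psi l u)) -
    2 * s u * s v * (\sum_l g l * (psi l v * psi l u)).
  rewrite !mulr_sumr -big_split -sumrB /=; apply: eq_bigr => l _.
  by rewrite /f; ring.
have : 0 <= \sum_(l < n) (lam`_l - lam`_1) * f l ^+ 2.
  apply: sumr_ge0 => l _; have [l0|l0] := posnP l.
    by rewrite f0 // mulr0.
  by rewrite mulr_ge0 ?sqr_ge0 // subr_ge0 (eigen_ge1 psiP).
under eq_bigr do rewrite mulrBl.
have E1 := fsum (fun=> 1).
have one (F : 'I_n -> R) : \sum_l 1 * F l = \sum_l F l.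
  by apply: eq_bigr => l _; rewrite mul1r.
rewrite !one in E1.
rewrite !(eigen_complete psiP) !eqxx (negbTE vu) mulr0 subr0 !mulr1 in E1.
rewrite sumrB -mulr_sumr E1 fsum !lamE !Aii Avu !eqxx (negbTE vu).
rewrite !subr0 mulr0 subr0 !mulr1 -[X in X - _]mul1r -mulrBl pmulr_lge0.
  by rewrite subr_ge0.
by rewrite addr_gt0 // exprn_gt0.
Qed.

Variable m : nat.
Let r := graph_dist e v u.
Let q := rho ^ (r%:Z - 1).
Let B := m%:R * a + c2^-1 * (- (tau * a / 4) + (gam + q) / lam`_1).

Let q_ge0 : 0 <= q.
Proof. exact: exprz_ge0. Qed.

Let c2V_ge0 : 0 <= c2^-1.
Proof. by rewrite invr_ge0 ltW. Qed.

Let B_ge0 : 0 <= B.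
Proof.
have q1 : 0 <= q / lam`_1 by rewrite divr_ge0 // ltW.
have : 0 <= - (tau * a / 4) + (gam + q) / lam`_1.
  by rewrite mulrDl; move: tau_le q1; lra.
move=> H; rewrite /B addr_ge0 //; first exact: mulr_ge0.
exact: mulr_ge0.
Qed.

(** For r = 0 the exponent in [q] is -1: then [q] is at least 1, unless [rho] = 0, whose inverse is
    0 by convention, so that the power must be a positive one. *)
Let rho_pow_le k : (r <= k)%N -> (0 < k)%N -> rho ^+ k <= q.
Proof.
move=> rk k0; rewrite /q; case: r rk => [|r'] rk.
  rewrite sub0r exprN1; have [->|rho0] := eqVneq rho 0.
    by rewrite invr0 expr0n gtn_eqF.
  apply: (@le_trans _ _ 1); first exact: exprn_ile1.
  by rewrite invf_ge1 // lt0r rho0.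
rewrite -addn1 PoszD addrK -exprnP.
by rewrite ler_wiXn2l // (leq_trans (leqnSn r')).
Qed.

(** In the first two cases the sums vanish or are empty and [B_ge0] settles them; in the third
    [rho_pow_le] is available. *)
Let trivial_or : (2 * m < r)%N \/ m = 0%N \/ (r <= 2 * m)%N /\ (0 < m)%N.
Proof.
have [|rm] := ltnP (2 * m) r; first by left.
by right; case: m rm => [|m'] rm; [left|right].
Qed.

Lemma sum_pw_le : \sum_(0 <= k < 2 * m) pw k v u <= B.
Proof.
have [mr|[->|[rm m0]]] := trivial_or.
- rewrite big_nat_cond big1 // => k /andP[/andP[_ km] _].
  by rewrite pw_lt_dist // (ltn_trans km).
- by rewrite big_geq.
rewrite sum_pw /B; have H1 := green_le; have H2 := rest_le (2 * m).
have H3 : rho ^+ (2 * m) <= q by apply: rho_pow_le => //; rewrite muln_gt0.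
have -> : (2 * m)%:R * a / 2 = m%:R * a by rewrite natrM; field.
rewrite lerD2l ler_wpM2l //; apply: (le_trans (lerD H1 H2)).
rewrite -addrA lerD2l -mulrDl ler_wpM2r ?invr_ge0 ?(ltW lam1_gt0) //.
have H4 : rho ^+ (2 * m) * (1 - a / 2) <= rho ^+ (2 * m) * 1.
  by rewrite ler_wpM2l ?exprn_ge0 // lerBlDr lerDl divr_ge0.
by move: H3 H4 a_ge0; lra.
Qed.

Lemma sum_pw_even_le : \sum_(t < m) pw (2 * t) v u <= B.
Proof.
apply: le_trans sum_pw_le.
elim: m => [|m' IH]; first by rewrite big_ord0 big_geq.
rewrite big_ord_recr /= mulnS !big_nat_recr //=.
by rewrite -[X in X <= _]addr0; apply: lerD; [apply: lerD|exact: pw_ge0].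
Qed.

(** A_sym T^k is T^k plus (T^(k+1) - T^k) / c2, and the second part telescopes. Its remainder of at
    most 1 / c2 is the origin of the term 2 cH / mu in the bound. *)
Lemma sum_apw_even_le : \sum_(t < m) apw (2 * t) v u <= B + c2^-1.
Proof.
apply: (@le_trans _ _ (\sum_(0 <= k < 2 * m) apw k v u)).
  elim: m => [|m' IH]; first by rewrite big_ord0 big_geq.
  rewrite big_ord_recr /= mulnS !big_nat_recr //=.
  by rewrite -[X in X <= _]addr0; apply: lerD; [apply: lerD|exact: apw_ge0].
have E1 K : \sum_(0 <= k < K) apw k v u =
    c2^-1 * (pw K v u - pw 0 v u) + \sum_(0 <= k < K) pw k v u.
  elim: K => [|K IH]; first by rewrite !big_geq // subrr mulr0 addr0.
  rewrite !big_nat_recr //= IH pw_recr; field.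
  by rewrite gt_eqF.
rewrite E1 addrC; apply: lerD; first exact: sum_pw_le.
by rewrite ler_piMr // pw0; have := pw_le1 (2 * m); case: (v == u) => /=; lra.
Qed.

(* The shift by one step costs an extra [a / 2]; it is absorbed by the slack
   [a / 2 / lam`_1] of [green_le] when [c2 * lam`_1 <= 1], and otherwise [v] and
   [u] are adjacent, so that [q = 1]. *)
Lemma sum_pw_even_succ_le : \sum_(t < m) pw (2 * t.+1) v u <= B.
Proof.
have [mr|[->|[rm m0]]] := trivial_or.
- rewrite big1 // => t _; rewrite pw_lt_dist //.
  by apply: leq_ltn_trans mr; rewrite leq_mul2l ltn_ord orbT.
- by rewrite big_ord0.
(* The indices 2, 4, ..., 2m lie between 1 and 2m, so the sum of all powers up to 2m may lose its
   term of index 0. *)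
apply: (@le_trans _ _ (\sum_(0 <= k < (2 * m).+1) pw k v u - pw 0 v u)).
  rewrite big_nat_recl // addrC addKr.
  elim: m => [|m' IH]; first by rewrite big_ord0 big_geq.
  rewrite big_ord_recr /= !mulnS !big_nat_recr //=.
  by rewrite lerD2r -[X in X <= _]addr0; apply: lerD; [exact: IH|exact: pw_ge0].
rewrite sum_pw pw0 /B.
have H1 := green_le; have H2 := rest_le (2 * m).+1.
have H3 : rho ^+ (2 * m).+1 <= q by apply: rho_pow_le => //; apply: leqW.
have -> : (2 * m).+1%:R * a / 2 = m%:R * a + a / 2.
  by rewrite -addn1 natrD natrM; field.
have kap : 0 < c2 * lam`_1 by rewrite mulr_gt0.
pose k := (c2 * lam`_1)^-1.
have H4 : c2^-1 * (G - rest (2 * m).+1) <= c2^-1 * (- (tau * a / 4)) +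
    k * (gam - a / 2 + rho ^+ (2 * m).+1 * (1 - a / 2)).
  have -> : c2^-1 * (- (tau * a / 4)) +
    k * (gam - a / 2 + rho ^+ (2 * m).+1 * (1 - a / 2)) =
    c2^-1 * (- (tau * a / 4) + (gam - a / 2) / lam`_1 +
      rho ^+ (2 * m).+1 * (1 - a / 2) / lam`_1).
    by rewrite /k; field; rewrite !gt_eqF.
  by rewrite ler_wpM2l // lerD.
have -> : c2^-1 * (- (tau * a / 4) + (gam + q) / lam`_1) =
    c2^-1 * (- (tau * a / 4)) + k * (gam + q).
  by rewrite /k; field; rewrite !gt_eqF.
suff H5 : a / 2 - (v == u)%:R +
    k * (- (a / 2) + rho ^+ (2 * m).+1 * (1 - a / 2) - q) <= 0.
  by move: H4 H5; lra.
have a2 : a / 2 <= 1.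
  have := sum_pos_abs_le.
  have : 0 <= \sum_(l < n | (0 < l)%N) `|psi l v * psi l u| by apply: sumr_ge0.
  lra.
have k_gt0 : 0 < k by rewrite invr_gt0.
have H6 : rho ^+ (2 * m).+1 * (1 - a / 2) <= rho ^+ (2 * m).+1 * 1.
  by rewrite ler_wpM2l ?exprn_ge0 // lerBlDr lerDl divr_ge0.
(* For [v] = [u] the subtracted entry 1 of T^0 already absorbs a / 2. *)
have [vu|vu] := eqVneq v u.
  have : k * (- (a / 2) + rho ^+ (2 * m).+1 * (1 - a / 2) - q) <= 0.
    by rewrite pmulr_rle0 //; move: H3 H6 a_ge0; lra.
  by move: a2; rewrite /=; lra.
rewrite /= subr0.
suff H7 : c2 * lam`_1 * (a / 2) - a / 2 + rho ^+ (2 * m).+1 * (1 - a / 2) <= q.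
  have -> : a / 2 + k * (- (a / 2) + rho ^+ (2 * m).+1 * (1 - a / 2) - q) =
    k * (c2 * lam`_1 * (a / 2) - a / 2 + rho ^+ (2 * m).+1 * (1 - a / 2) - q).
    by rewrite /k; field; rewrite !gt_eqF.
  by rewrite pmulr_rle0 // subr_le0.
have [k1|k1] := leP (c2 * lam`_1) 1.
  have : c2 * lam`_1 * (a / 2) <= 1 * (a / 2) by rewrite ler_wpM2r // divr_ge0.
  by move: H3 H6; lra.
have krho : c2 * lam`_1 - 1 <= rho.
  have := rhoP (l := Ordinal n_gt1) isT; rewrite /x /= ler_norml.
  by move=> /andP[H _]; lra.
have r1 : r = 1%N.
  have r0 : (0 < r)%N.
    by rewrite lt0n; apply: contra vu => /eqP/graph_dist_eq0 ->.
  apply/eqP; rewrite eqn_leq r0 andbT leqNgt; apply/negP => r2.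
  (* At distance at least 2 the (v, u) entry of T vanishes, and this entry is [c2 * A v u]. *)
  have := pw_lt_dist r2; rewrite pw_recr pw0 (negbTE vu) mulr0 add0r -sum_A_pw.
  rewrite (bigD1 u) //= pw0 eqxx mulr1 big1 ?addr0 => [|j ju]; last first.
    by rewrite pw0 (negbTE ju) mulr0.
  move=> /eqP; rewrite mulf_eq0 gt_eqF //= => /eqP Avu.
  have := nonadjacent_lam1_le1 vu Avu => l1.
  have : c2 * lam`_1 <= 1 * 1 by apply: ler_pM => //; apply: ltW.
  by move: k1; lra.
have qE : q = 1 by rewrite /q r1 subrr expr0z.
have H8 : (c2 * lam`_1 - 1) * (a / 2) <= 1 * (a / 2).
  apply: ler_wpM2r; first by rewrite divr_ge0.
  exact: le_trans krho rho_le1.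
have H9 : rho ^+ (2 * m).+1 * (1 - a / 2) <= 1 * (1 - a / 2).
  by rewrite ler_wpM2r ?subr_ge0 // exprn_ile1.
by move: H8 H9; rewrite qE; lra.
Qed.

End LazyWalkPowers.

(** * Mixing bound *)

Section MixingBound.
Variables (R : realType) (n d m : nat) (e : rel 'I_n) (lam : seq R).
Hypotheses (simple_e : simple_graph e) (conn_e : connected_graph e)
  (n_gt1 : (1 < n)%N).
Variable psi : 'I_n -> 'I_n -> R.
Hypothesis psiP : laplacian_eigenbasis e lam psi.
Variables (N : mpnn R d) (omega w c1 c2 cH : R).
Hypothesis HN : mpnn_bounds m N omega w c1 c2 cH.
Let gam := deg_ratio R e.
Hypotheses (w_le1 : w <= 1) (sum_le1 : omega / w + c1 * gam + c2 <= 1).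

Let A := A_sym R e.
Let s := sdeg R e.
Let pwr := pw lam psi c2.
Let apwr := apw lam psi c2.
Let w_gt0 := w_gt0 HN.
Let c2_gt0 := c2_gt0 HN.
Let cH_ge0 := cH_ge0 HN.
Let A_ge0 i j : 0 <= A i j.
Proof. exact: A_sym_ge0. Qed.
Let gam_ge1 : 1 <= gam.
Proof. exact: deg_ratio_ge1. Qed.

Lemma c2_le1 : c2 <= 1.
Proof.
apply: le_trans sum_le1; rewrite lerDr addr_ge0 ?divr_ge0 ?mulr_ge0 //.
- exact: omega_ge0 HN.
- exact: ltW.
- exact: c1_ge0 HN.
- exact: le_trans ler01 gam_ge1.
Qed.

Let pwr_ge0 k i j : 0 <= pwr k i j.
Proof. exact: (pw_ge0 psiP c2_gt0 c2_le1). Qed.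

Let pwr_step k i j :
  pwr k.+1 i j = (1 - c2) * pwr k i j + c2 * \sum_l A i l * pwr k l j.
Proof. by rewrite /pwr pw_recr (sum_A_pw psiP). Qed.

(** The smallness hypothesis is spent here: the terms in [y i] have total coefficient at most omega
    + w c1 gamma <= w (1 - c2), and w <= 1 removes the remaining factors. *)
Lemma propagation_le (y : 'I_n -> R) i : (forall j, 0 <= y j) ->
  omega * y i + w * (\sum_j A i j * (c1 * y i + c2 * y j)) <=
  (1 - c2) * y i + c2 * \sum_j A i j * y j.
Proof.
move=> y0; have Ay0 : 0 <= \sum_j A i j * y j by apply: sumr_ge0 => j _; rewrite mulr_ge0.
have -> : \sum_j A i j * (c1 * y i + c2 * y j) =
    c1 * (\sum_j A i j) * y i + c2 * \sum_j A i j * y j.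
  rewrite [c1 * \sum_j _]mulr_sumr mulr_suml [c2 * \sum_j _]mulr_sumr -big_split /=.
  by apply: eq_bigr => j _; ring.
rewrite mulrDr addrA; apply: lerD; last first.
  by rewrite ler_piMl // mulr_ge0 // ltW.
have H : omega + w * c1 * (\sum_j A i j) <= 1 - c2.
  apply: (@le_trans _ _ (w * (omega / w + c1 * gam))).
    rewrite mulrDr mulrCA divff ?gt_eqF // mulr1 lerD2l -mulrA ler_wpM2l ?(ltW w_gt0) //.
    rewrite ler_wpM2l ?(c1_ge0 HN) //.
    exact: sum_A_sym_le.
  have c2' : 0 <= 1 - c2 by rewrite subr_ge0 c2_le1.
  apply: (@le_trans _ _ (w * (1 - c2))); last by rewrite ler_piMl.
  by rewrite ler_wpM2l ?(ltW w_gt0) // lerBrDr.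
have := ler_wpM2r (y0 i) H; rewrite mulrDl !mulrA; lra.
Qed.

(** T is symmetric and fixes [s], so pairing with [s] is invariant under a propagation step and the
    sources add up without amplification. *)
Lemma weighted_growth (y src : nat -> 'I_n -> R) :
  (forall i, y 0%N i = 0) ->
  (forall t i, (t < m)%N ->
     y t.+1 i <= (1 - c2) * y t i + c2 * (\sum_j A i j * y t j) + src t i) ->
  forall t, (t <= m)%N ->
    \sum_i s i * y t i <= \sum_i s i * \sum_(k < t) src k i.
Proof.
move=> y0 ystep; elim=> [|t IH] tm.
  rewrite big1 => [|i _]; last by rewrite y0 mulr0.
  by apply: sumr_ge0 => i _; rewrite big_ord0 mulr0.
have prop : \sum_i s i * ((1 - c2) * y t i + c2 * \sum_j A i j * y t j) =
    \sum_i s i * y t i.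
  have sA : \sum_i s i * \sum_j A i j * y t j = \sum_j s j * y t j.
    under eq_bigr do rewrite mulr_sumr.
    rewrite exchange_big /=; apply: eq_bigr => j _.
    rewrite -[s j](A_sym_sdeg R conn_e n_gt1 j) mulr_suml.
    by apply: eq_bigr => i _; rewrite (A_symC R simple_e j i) -/(A i j) -/(s i); ring.
  transitivity ((1 - c2) * (\sum_i s i * y t i) +
      c2 * \sum_i s i * \sum_j A i j * y t j).
    by rewrite !mulr_sumr -big_split /=; apply: eq_bigr => i _; ring.
  by rewrite sA; ring.
apply: (@le_trans _ _ (\sum_i (s i *
    ((1 - c2) * y t i + c2 * \sum_j A i j * y t j) + s i * src t i))).
  by apply: ler_sum => i _; rewrite -mulrDr ler_wpM2l ?sqrtr_ge0 // ystep.
rewrite big_split /= prop.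
apply: le_trans (lerD (IH (ltnW tm)) (lexx _)) _.
rewrite -big_split /=; apply: ler_sum => i _.
by rewrite big_ord_recr /= mulrDr.
Qed.

Variables (v u : 'I_n) (al be : 'I_d) (X : 'M[R]_(n, d)).

Let p t (y : 'I_n) (g : 'I_d) i := norm2 (dvec (hid N A t i) (delta_mx y g) X).
Let z t i := norm2 (d2vec (hid N A t i) (delta_mx v al) (delta_mx u be) X).

Lemma jacobian_le t y g i : (t <= m)%N -> p t y g i <= pwr t i y.
Proof.
elim: t i => [|t IH] i tm; first by rewrite /p norm2_dvec_hid0 /pwr (pw0 psiP).
apply: le_trans (norm2_dvec_hidS HN A_ge0 _ _ _ tm) _.
apply: le_trans (propagation_le (y := p t y g) i (fun _ => norm2_ge0 _)) _.
rewrite pwr_step; apply: lerD.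
  by rewrite ler_wpM2l ?subr_ge0 ?c2_le1 // IH // ltnW.
rewrite ler_wpM2l ?(ltW c2_gt0) //; apply: ler_sum => j _.
by rewrite ler_wpM2l // IH // ltnW.
Qed.

(** What layer t + 1 adds to the mixed derivatives: the first product stems from the second
    derivative of the activation, the sum from the Hessian of the message. *)
Let source t i := pwr t.+1 i v * pwr t.+1 i u +
  cH * \sum_j A i j * ((pwr t i v + pwr t j v) * (pwr t i u + pwr t j u)).

Lemma source_ge0 t i : 0 <= source t i.
Proof.
rewrite addr_ge0 ?mulr_ge0 // sumr_ge0 // => j _.
by rewrite !mulr_ge0 ?addr_ge0.
Qed.

Lemma source_dominates t (y pa pb : 'I_n -> R) i :
  (forall j, 0 <= y j) -> (forall j, 0 <= pa j) -> (forall j, 0 <= pb j) ->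
  (forall j, pa j <= pwr t j v) -> (forall j, pb j <= pwr t j u) ->
  omega * y i + w * (\sum_j A i j * (c1 * y i + c2 * y j +
     cH * ((pa i + pa j) * (pb i + pb j)))) <=
  (1 - c2) * y i + c2 * (\sum_j A i j * y j) +
  cH * \sum_j A i j * ((pwr t i v + pwr t j v) * (pwr t i u + pwr t j u)).
Proof.
move=> y0 pa0 pb0 pa_le pb_le.
rewrite (eq_bigr (fun j => A i j * (c1 * y i + c2 * y j) +
    cH * (A i j * ((pa i + pa j) * (pb i + pb j))))); last by move=> j _; ring.
rewrite big_split /= -mulr_sumr mulrDr addrA; apply: lerD.
  exact: propagation_le.
have V0 : 0 <= \sum_j A i j * ((pa i + pa j) * (pb i + pb j)).
  by apply: sumr_ge0 => j _; rewrite !mulr_ge0 ?addr_ge0.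
apply: (@le_trans _ _ (cH * \sum_j A i j * ((pa i + pa j) * (pb i + pb j)))).
  by rewrite ler_piMl // mulr_ge0.
rewrite ler_wpM2l //; apply: ler_sum => j _; rewrite ler_wpM2l //.
by apply: ler_pM; rewrite ?addr_ge0 // lerD.
Qed.

Lemma hessian_step t i : (t < m)%N ->
  z t.+1 i <= (1 - c2) * z t i + c2 * (\sum_j A i j * z t j) + source t i.
Proof.
move=> tm; have z0 j : 0 <= z t j by apply: norm2_ge0.
have pP y g : omega * p t y g i + w * (\sum_j A i j * (c1 * p t y g i + c2 * p t y g j)) <=
    pwr t.+1 i y.
  apply: le_trans (propagation_le (y := p t y g) i (fun _ => norm2_ge0 _)) _.
  rewrite pwr_step; apply: lerD.
    by rewrite ler_wpM2l ?subr_ge0 ?c2_le1 // jacobian_le // ltnW.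
  rewrite ler_wpM2l ?(ltW c2_gt0) //; apply: ler_sum => j _.
  by rewrite ler_wpM2l // jacobian_le // ltnW.
apply: le_trans (norm2_d2vec_hidS HN A_ge0 tm (pP v al) (pP u be)) _.
have H := source_dominates (t := t) (pa := p t v al) (pb := p t u be) i z0
  (fun _ => norm2_ge0 _) (fun _ => norm2_ge0 _)
  (fun j => jacobian_le v al j (ltnW tm)) (fun j => jacobian_le u be j (ltnW tm)).
by apply: le_trans (lerD (lexx _) H) _; rewrite addrCA.
Qed.

Lemma weighted_hessian_le t : (t <= m)%N ->
  \sum_i s i * z t i <= \sum_i s i * \sum_(k < t) source k i.
Proof.
apply: weighted_growth => [i|k i]; first by rewrite /z norm2_d2vec_hid0.
exact: hessian_step.
Qed.

(** Expanding the product gives two terms with both factors at one end of the edge, each bounded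
    through the row sums by gam T^(2t), and two cross terms, each equal to A_sym T^(2t). Symmetry
    pairs them, whence the factor 2. *)
Lemma sum_source_le t : \sum_i source t i <=
  pwr (2 * t.+1) v u + 2 * cH * (gam * pwr (2 * t) v u + apwr (2 * t) v u).
Proof.
rewrite big_split /= (pw_conv psiP) addnn -mul2n lerD2l -mulr_sumr.
rewrite [2 * cH]mulrC -mulrA ler_wpM2l //.
have -> : \sum_i \sum_j A i j * ((pwr t i v + pwr t j v) * (pwr t i u + pwr t j u)) =
    2 * \sum_i (\sum_j A i j) * (pwr t i v * pwr t i u) + 2 * apwr (2 * t) v u.
  have swap (F : 'I_n -> 'I_n -> R) :
      \sum_i \sum_j A i j * F i j = \sum_i \sum_j A i j * F j i.
    rewrite exchange_big /=; apply: eq_bigr => i _; apply: eq_bigr => j _.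
    by rewrite /A (A_symC R simple_e).
  have cross := apw_conv psiP c2_gt0 t t v u; rewrite addnn -mul2n in cross.
  transitivity (\sum_i \sum_j A i j * (pwr t i v * pwr t i u) +
      \sum_i \sum_j A i j * (pwr t j v * pwr t j u) +
      (\sum_i \sum_j A i j * (pwr t i v * pwr t j u) +
       \sum_i \sum_j A i j * (pwr t j v * pwr t i u))).
    rewrite -!big_split /=; apply: eq_bigr => i _.
    by rewrite -!big_split /=; apply: eq_bigr => j _; ring.
  rewrite (swap (fun i j => pwr t j v * pwr t j u)).
  rewrite (swap (fun i j => pwr t j v * pwr t i u)) cross.
  have -> : \sum_i \sum_j A i j * (pwr t i v * pwr t i u) =
      \sum_i (\sum_j A i j) * (pwr t i v * pwr t i u).
    by apply: eq_bigr => i _; rewrite -mulr_suml.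
  rewrite /apwr; move: (\sum_i _) (apw _ _ _ _ _ _) => x1 x2; ring.
have conv : \sum_i pwr t i v * pwr t i u = pwr (2 * t) v u.
  by rewrite (pw_conv psiP) addnn mul2n.
rewrite -mulrDr ler_wpM2l // lerD2r -conv mulr_sumr.
apply: ler_sum => i _; rewrite ler_wpM2r ?mulr_ge0 //.
exact: sum_A_sym_le.
Qed.

Lemma sum_hessian_le : \sum_i z m i <= gam *
  (\sum_(t < m) pwr (2 * t.+1) v u + 2 * cH *
    (gam * \sum_(t < m) pwr (2 * t) v u + \sum_(t < m) apwr (2 * t) v u)).
Proof.
have S0 i : 0 <= \sum_(k < m) source k i.
  by apply: sumr_ge0 => k _; apply: source_ge0.
have z0 i : 0 <= z m i by apply: norm2_ge0.
apply: le_trans (weighted_sum_le conn_e n_gt1 z0 S0 (weighted_hessian_le (leqnn m))) _.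
rewrite ler_wpM2l ?(le_trans ler01) // exchange_big /=.
rewrite [gam * _]mulr_sumr -big_split mulr_sumr -big_split /=.
by apply: ler_sum => t _; apply: sum_source_le.
Qed.

End MixingBound.

(** * Depth lower bound *)

Section Final.
Variables (R : realType) (n d m : nat) (e : rel 'I_n) (v u : 'I_n) (lam : seq R).
Variables (disp : measure_display) (Om : measurableType disp)
  (P : probability Om R) (S : nat -> Om -> 'I_n).
Variables (N : mpnn R d) (omega w c1 c2 cH : R).
Hypotheses (simple_e : simple_graph e) (conn_e : connected_graph e)
  (nbip_e : ~ bipartite e) (spec : is_spectrum (norm_lap R e) lam)
  (walkS : simple_random_walk e P S v)
  (HN : mpnn_bounds m N omega w c1 c2 cH).
Let gam := deg_ratio R e.
Let mu := 1 + 2 * cH * (1 + gam).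
Let rho := \big[Num.max/0]_(1 <= l < n) `|1 - c2 * lam`_l|.
Let r := graph_dist e v u.
Hypothesis small : Num.max w (omega / w + c1 * gam + c2) <= 1.

Lemma card_gt1_of_not_bipartite : (1 < n)%N.
Proof.
rewrite ltnNge; apply/negP => n1; apply: nbip_e; exists (fun=> true) => x y.
have -> : x = y.
  have ordE (k : 'I_n) : k = 0 :> nat.
    by apply/eqP; rewrite -leqn0 -ltnS (leq_trans (ltn_ord k)).
  by apply/val_inj; rewrite /= !ordE.
by rewrite simple_e.2.
Qed.

(** Keeps the set defining [mixing] nonempty, so that the mixing is at least 0 and not -oo. *)
Lemma feature_dim_gt0 : (0 < d)%N.
Proof.
case: (posnP d) => // d0; have := out_unit HN; move: (out_vec N).
rewrite d0 => th; rewrite /norm2 big_ord0 sqrtr0 => /eqP.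
by rewrite eq_sym oner_eq0.
Qed.

Lemma depth_lower_bound (z : 'M[R]_(n, d) -> R) :
  twice_differentiable z -> mpnn_output N (A_sym R e) m = z ->
  (commute_time P S v u * ((4 * c2)^-1)%:E +
     ((num_edges e)%:R / Num.sqrt ((deg e v)%:R * (deg e u)%:R))%:E *
     (mixing z v u * ((gam * mu)^-1)%:E -
      (c2^-1 * ((gam + rho ^ (r%:Z - 1)) / lam`_1 + 2 * (cH / mu)))%:E)
     <= (m%:R)%:E)%E.
Proof.
move=> z2 zE.
have n_gt1 := card_gt1_of_not_bipartite.
have [psi psiP] := laplacian_eigenbasis_exists simple_e conn_e n_gt1 spec.
move: small; rewrite ge_max => /andP[w1 sum1].
have c2_gt0 := c2_gt0 HN; have cH_ge0 := cH_ge0 HN.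
have c2_1 : c2 <= 1 := c2_le1 conn_e n_gt1 HN sum1.
have gam1 : 1 <= gam := deg_ratio_ge1 R conn_e n_gt1.
have mu_gt0 : 0 < mu by rewrite ltr_pwDl // !mulr_ge0 // addr_ge0 // (le_trans ler01).
have gam_gt0 : 0 < gam by apply: lt_le_trans gam1.
have lam_bd (l : 'I_n) : `|1 - c2 * lam`_l| <= 1.
  have /andP[l0 l2] := eigen_le2 psiP l; rewrite ler_norml.
  have : c2 * lam`_l <= 1 * 2 by apply: ler_pM => //; apply: ltW.
  have : 0 <= c2 * lam`_l by rewrite mulr_ge0 // ltW.
  by move=> h1 h2; apply/andP; split; lra.
have rho1 : rho <= 1.
  rewrite /rho big_nat_cond; apply: bigmax_le => // l /andP[/andP[_ ln] _].
  exact: (lam_bd (Ordinal ln)).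
have rhoP (l : 'I_n) : (0 < l)%N -> `|1 - c2 * lam`_l| <= rho.
  move=> l0; apply: (bigmax_sup_seq _ (nat_of_ord l)) => //.
  by rewrite mem_index_iota l0 ltn_ord.
have gamP i j : sdeg R e i <= gam * sdeg R e j by apply: sdeg_le_ratio.
have F1 := sum_pw_even_succ_le simple_e conn_e n_gt1 psiP c2_gt0 c2_1 v u rho1 rhoP gamP m.
have F2 := sum_pw_even_le simple_e conn_e n_gt1 psiP c2_gt0 c2_1 v u rho1 rhoP gamP m.
have F3 := sum_apw_even_le simple_e conn_e n_gt1 psiP c2_gt0 c2_1 v u rho1 rhoP gamP m.
move: F1 F2 F3; rewrite -/r.
set tauF := 2 * _ * _.
have tau_le : (commute_time P S v u <= tauF%:E)%E.
  rewrite /tauF -(hitting_commute lam conn_e n_gt1 psi u v).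
  exact: (commute_time_le u (hitting_self e lam psi)
    (hitting_ge0 simple_e conn_e n_gt1 psiP)
    (@hitting_step _ _ _ _ simple_e conn_e n_gt1 _ psiP)
    (sum_step R conn_e n_gt1) walkS).
set E := (num_edges e)%:R; set a := _ / E.
set B := _ + _ => F1 F2 F3.
(* An extended real between 0 and a real number is real; the mixing is treated likewise below, so
   that the rest is real arithmetic. *)
have [t tE t_le] : exists2 t, commute_time P S v u = t%:E & t <= tauF.
  have := commute_time_ge0 v u P S; move: tau_le.
  by case: (commute_time P S v u) => [t| |] //=; rewrite lee_fin => h _; exists t.
have mix_le : (mixing z v u <= (gam * (mu * B + 2 * cH / c2))%:E)%E.
  apply: ge_ereal_sup => _ [X [al [be ->]]]; rewrite lee_fin.
  apply: le_trans (normr_derive2_mpnn HN v _ _ _ z2 zE) _.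
  apply: le_trans (sum_hessian_le simple_e conn_e n_gt1 psiP HN w1 sum1 v u al be X) _.
  rewrite -/gam ler_wpM2l ?(ltW gam_gt0) //.
  have := ler_wpM2l (ltW gam_gt0) F2.
  move=> gF2; have cH2 : 0 <= 2 * cH by rewrite mulr_ge0.
  have := ler_wpM2l cH2 (lerD gF2 F3).
  by rewrite /mu; move: F1; lra.
have [M mixE M_le] : exists2 M, mixing z v u = M%:E &
    M <= gam * (mu * B + 2 * cH / c2).
  have mix_ge0 : (0 <= mixing z v u)%E.
    apply: (@le_trans _ _ (`|'D_(delta_mx v (Ordinal feature_dim_gt0))
        ('D_(delta_mx u (Ordinal feature_dim_gt0)) z) 0|)%:E).
      by rewrite lee_fin.
    apply: ereal_sup_ubound.
    by exists 0, (Ordinal feature_dim_gt0), (Ordinal feature_dim_gt0).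
  move: mix_le mix_ge0.
  by case: (mixing z v u) => [M| |] //=; rewrite lee_fin => h _; exists M.
rewrite tE mixE -!(EFinM, EFinD, EFinB) lee_fin.
rewrite sqrtrM // -/(sdeg R e v) -/(sdeg R e u) -/E.
have s_gt0 i : 0 < sdeg R e i by apply: sdeg_gt0.
have E_gt0 : 0 < E by apply: num_edges_gt0.
have -> : E / (sdeg R e v * sdeg R e u) = a^-1.
  by rewrite /a; field; rewrite !gt_eqF.
have a_gt0 : 0 < a by rewrite divr_gt0 ?mulr_gt0.
have M_le' : M / (gam * mu) <= B + 2 * cH / c2 / mu.
  rewrite ler_pdivrMr ?mulr_gt0 //.
  rewrite (_ : (B + _) * _ = gam * (mu * B + 2 * cH / c2)) //.
  by field; rewrite !gt_eqF.
have t4 : t * (4 * c2)^-1 <= tauF * (4 * c2)^-1.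
  by rewrite ler_wpM2r // invr_ge0 mulr_ge0 // ltW.
apply: (le_trans (lerD t4 (ler_wpM2l (ltW (_ : 0 < a^-1)) (lerB M_le' (lexx _))))).
  by rewrite invr_gt0.
(* With both upper bounds inserted, the commute-time, spectral and Hessian terms cancel and the left
   side is exactly m. *)
rewrite le_eqVlt; apply/orP; left; apply/eqP.
have lam1_gt0 := eigen1_gt0 psiP.
rewrite /B; move: (rho ^ _) => q; move: (tauF) => T.
clearbody a; field.
by rewrite !gt_eqF.
Qed.

End Final.

Theorem corollary4p5 (R : realType) (n d m : nat) (e : rel 'I_n)
  (v u : 'I_n) (lam : seq R)
  (disp : measure_display) (Om : measurableType disp) (P : probability Om R)
  (S : nat -> Om -> 'I_n)
  (N : mpnn R d) (omega w c1 c2 cH : R) (yG : 'M[R]_(n, d) -> R) :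
  simple_graph e -> connected_graph e -> ~ bipartite e ->
  is_spectrum (norm_lap R e) lam ->
  simple_random_walk e P S v ->
  mpnn_bounds m N omega w c1 c2 cH ->
  twice_differentiable yG ->
  let gamma := deg_ratio R e in
  let mu := 1 + 2 * cH * (1 + gamma) in
  let rho := \big[Num.max/0]_(1 <= l < n) `|1 - c2 * lam`_l| in
  let r := graph_dist e v u in
  let tau := commute_time P S v u in
  Num.max w (omega / w + c1 * gamma + c2) <= 1 ->
  ~ (tau * ((4 * c2)^-1)%:E +
     ((num_edges e)%:R / Num.sqrt ((deg e v)%:R * (deg e u)%:R))%:E *
     (mixing yG v u * ((gamma * mu)^-1)%:E -
      (c2^-1 * ((gamma + rho ^ (r%:Z - 1)) / lam`_1 + 2 * (cH / mu)))%:E)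
     <= (m%:R)%:E)%E ->
  forall z : 'M[R]_(n, d) -> R,
    twice_differentiable z -> mixing z v u = mixing yG v u ->
    mpnn_output N (A_sym R e) m <> z.
Proof.
move=> simple_e conn_e nbip_e spec walkS HN yG2 gamma mu rho r tau small nle z z2 mixE zE.
apply: nle; rewrite -mixE.
exact: (depth_lower_bound u simple_e conn_e nbip_e spec walkS HN small z2 zE).
Qed.
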